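(* Let $\mu=\sum_{i=1}^{n}a_{i}\delta_{x_{i}}$ and $\nu=\sum_{j=1}^{m}b_{j}\delta_{y_{j}}$ be discrete probability measures on $\mathbb{R}^{d}$ with $a_{i},b_{j}>0$, $\sum_{i=1}^{n}a_{i}=\sum_{j=1}^{m}b_{j}=1$, with $x_{1},\dots,x_{n}$ pairwise distinct and $y_{1},\dots,y_{m}$ pairwise distinct. Let $\gamma\in\mathscr{P}(\mathbb{R}^{d}\times\mathbb{R}^{d})$ have a positive and bounded density $\rho$ with respect to the Lebesgue measure, and assume that $\rho$ is locally continuous at $(x_{i},y_{j})$ (i.e. continuous in a neighbourhood of it) for all $1\le i\le n$, $1\le j\le m$. For $\varepsilon>0$ let $\pi^{*,\varepsilon}$ be the unique minimizer over $\pi\in\mathscr{P}(\mathbb{R}^{d}\times\mathbb{R}^{d})$ of $$I^{\varepsilon}(\pi)=\varepsilon^{-1}\operatorname{OT}(\mu,\pi_{x})+\varepsilon^{-1}\operatorname{OT}(\nu,\pi_{y})+H(\pi|\gamma).$$ Then $\pi^{*,\varepsilon}$ converges weakly to $\pi^{*,0}$ as $\varepsilon\to0$, where $\pi^{*,0}$ is the unique solution of $$\inf_{\pi\in\Pi(\mu,\nu)}H(\pi|\sigma),\qquad \sigma=\sum_{i=1}^{n}\sum_{j=1}^{m}(2\pi)^{d}\rho(x_{i},y_{j})\,\delta_{(x_{i},y_{j})}$$ (in the factor $(2\pi)^{d}$, $\pi$ is the number pi). Furthermore, $$I^{\varepsilon}(\pi^{*,\varepsilon})=-d\ln\varepsilon+H(\pi^{*,0}|\sigma)+o(1)\quad\text{as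 }\varepsilon\to0.$$
   Context: $\mathscr{P}(\mathcal{Z})$ denotes Borel probability measures on $\mathcal{Z}$; $\Pi(\mu,\nu)$ denotes couplings of $\mu$ and $\nu$; $\pi_{x},\pi_{y}$ are the first and second marginals of $\pi$. For a probability measure $\pi$ and a positive (not necessarily probability) measure $\sigma$, $H(\pi|\sigma)=E_{\pi}[\log(\mathrm{d}\pi/\mathrm{d}\sigma)]$ if $\pi\ll\sigma$ and $+\infty$ otherwise. The transport cost is the quadratic one: $\operatorname{OT}(\mu,\mu')=\inf_{\kappa\in\Pi(\mu,\mu')}E_{\kappa}[\tfrac12\|X-X'\|^{2}]$. *)

(* Defs.v *)
From HB Require Import structures.
From mathcomp Require Import all_boot all_order all_algebra.
From mathcomp Require Import all_classical all_reals all_analysis.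
From mathcomp Require Import measurable_realfun giry.
Set Implicit Arguments.
Unset Strict Implicit.
Unset Printing Implicit Defensive.
Import Order.TTheory GRing.Theory Num.Theory.
Import numFieldNormedType.Exports.
Local Open Scope classical_set_scope.
Local Open Scope ring_scope.

Definition rV_display : measure_display. Proof. exact. Qed.

Section borel_rV.
Context {R : realType} {n : nat}.

Let borel : set (set 'rV[R]_n) := <<s @open 'rV[R]_n >>.

Let borel0 : borel set0. Proof. exact: sigma_algebra0. Qed.

Let borelC A : borel A -> borel (~` A). Proof. exact: sigma_algebraC. Qed.

Let borelU (F : (set 'rV[R]_n)^nat) :
  (forall i, borel (F i)) -> borel (\bigcup_i F i).
Proof. exact: sigma_algebra_bigcup. Qed.

HB.instance Definition _ := @isMeasurable.Build rV_display 'rV[R]_n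
  borel borel0 borelC borelU.

Lemma measurable_coord (i : 'I_n) :
  measurable_fun [set: 'rV[R]_n] (fun v => v ord0 i).
Proof.
apply: (measurability _ (RGenOpens.measurableE R)) => _ [_ [a [b ->] <-]].
rewrite setTI; apply: sub_sigma_algebra.
apply: open_comp; last exact: interval_open.
by move=> v _; exact: coord_continuous.
Qed.

Lemma measurable_rV d (T : measurableType d) (f : T -> 'rV[R]_n) :
  (forall i, measurable_fun setT (fun t => f t ord0 i)) ->
  measurable_fun setT f.
Proof.
move=> mf; apply: (measurability (@open 'rV[R]_n)) => // _ [U oU <-].
rewrite setTI.
pose B (p : 'rV[rat]_n * nat) : set 'rV[R]_n :=
  [set v | forall i, ball (ratr (p.1 ord0 i) : R) p.2.+1%:R^-1 (v ord0 i)].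
have -> : U = \bigcup_(p in [set p | B p `<=` U]) B p.
  apply/seteqP; split => [v Uv|v [p pU Bv]]; last exact: pU.
  have /nbhs_ballP[e /= e0 veU] : nbhs v U by exact: open_nbhs_nbhs.
  have [k ke] : exists k, k.+1%:R^-1 < e / 2 :> R.
    have e20 : 0 < e / 2 by rewrite divr_gt0.
    have [k _ /(_ k (leqnn k))] := near_infty_natSinv_lt (PosNum e20).
    by exists k.
  have k0 : 0 < k.+1%:R^-1 :> R by rewrite invr_gt0.
  have qP (i : 'I_n) : exists q : rat, ball (v ord0 i) k.+1%:R^-1 (ratr q).
    have [||r [Br [q _ qr]]] := @dense_rat R (ball (v ord0 i) k.+1%:R^-1).
    - by exists (v ord0 i); exact: ballxx.
    - exact: ball_open.
    - by exists q; rewrite qr.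
  exists (\row_i sval (cid (qP i)), k); last first.
    by move=> i /=; rewrite mxE; apply: ball_sym; exact: (svalP (cid (qP i))).
  move=> w /= Bw; apply: veU; split => // a i; rewrite ord1.
  rewrite (splitr e); apply: ball_triangle; last first.
    by apply: le_ball (Bw i); exact: ltW.
  by apply: le_ball (ltW ke) _ _; rewrite mxE; exact: (svalP (cid (qP i))).
rewrite preimage_bigcup bigcup_mkcond.
apply: countable_bigcupT_measurable => // -[q k]; case: ifP => // _.
rewrite (_ : _ @^-1` _ = \bigcap_(i in [set: 'I_n])
    ((fun t => f t ord0 i) @^-1` ball (ratr (q ord0 i) : R) k.+1%:R^-1)).
  apply: fin_bigcap_measurable => // i _.
  by rewrite -[X in measurable X]setTI; apply: mf => //; exact: measurable_ball.
by apply/seteqP; split => t /= Bt i; [move=> _|]; exact: Bt.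
Qed.

End borel_rV.

Definition cons_rV (R : realType) n (p : measurableTypeR R * 'rV[R]_n) :
    'rV[R]_n.+1 :=
  row_mx (const_mx p.1 : 'rV[R]_1) p.2.

Section lebesgue_rV_cons.
Context {R : realType} {n : nat}.

Lemma measurable_cons_rV : measurable_fun setT (@cons_rV R n).
Proof.
apply: measurable_rV => i.
under eq_fun do rewrite mxE.
case: (@fintype.split 1 n i) => j.
  under eq_fun do rewrite mxE.
  exact: measurable_fst.
exact: (measurableT_comp (measurable_coord j) measurable_snd).
Qed.

Let uncons (v : 'rV[R]_n.+1) : measurableTypeR R * 'rV[R]_n :=
  (v ord0 ord0, \row_j v ord0 (lift ord0 j)).

Let measurable_uncons : measurable_fun setT uncons.
Proof.
apply: measurable_fun_pair; first exact: measurable_coord.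
apply: measurable_rV => i; under eq_fun do rewrite mxE.
exact: measurable_coord.
Qed.

Let cons_rVK : cancel (@cons_rV R n) uncons.
Proof.
move=> [x v]; congr (_, _); rewrite /cons_rV /=.
  by rewrite mxE; case: split_ordP => // j; rewrite ?mxE.
apply/rowP => j; rewrite !mxE; case: split_ordP => k.
  by rewrite ord1 => /(congr1 val).
by move=> /(congr1 val) /= [/val_inj ->].
Qed.

Variable m : {sigma_finite_measure set 'rV[R]_n -> \bar R}.

Definition lebesgue_rV_cons : set 'rV[R]_n.+1 -> \bar R :=
  pushforward (lebesgue_measure \x m)%E (@cons_rV R n).

Let cons0 : lebesgue_rV_cons set0 = 0%E.
Proof. by rewrite /lebesgue_rV_cons /pushforward preimage_set0 measure0. Qed.

Let cons_ge0 A : (0 <= lebesgue_rV_cons A)%E.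
Proof. exact: (measure_ge0 (lebesgue_measure \x m)%E). Qed.

Let cons_sigma_additive : semi_sigma_additive lebesgue_rV_cons.
Proof.
by have mcons := measurable_cons_rV; exact: measure_semi_sigma_additive.
Qed.

HB.instance Definition _ := isMeasure.Build _ _ _ lebesgue_rV_cons
  cons0 cons_ge0 cons_sigma_additive.

Let cons_sigma_finite : sigma_finite setT lebesgue_rV_cons.
Proof.
have /sigma_finiteP[F [FT ndF Foo]] :=
  sigma_finiteT (@lebesgue_measure R : {sigma_finite_measure set _ -> \bar R}).
have /sigma_finiteP[G [GT ndG Goo]] := sigma_finiteT m.
exists (fun k => uncons @^-1` (F k `*` G k)).
  apply/esym; rewrite -subTset => v _.
  have [i _ Fi] : (\bigcup_i F i) (uncons v).1 by rewrite -FT.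
  have [j _ Gj] : (\bigcup_i G i) (uncons v).2 by rewrite -GT.
  exists (maxn i j) => //; split.
    exact: (subsetPset _ _ (ndF _ _ (leq_maxl i j))).
  exact: (subsetPset _ _ (ndG _ _ (leq_maxr i j))).
move=> k; have [[mF Fk] [mG Gk]] := (Foo k, Goo k); split.
  rewrite -[X in measurable X]setTI; apply: measurable_uncons => //.
  exact: measurableX.
rewrite /lebesgue_rV_cons /pushforward -comp_preimage.
rewrite (_ : _ \o _ = id) ?preimage_id; last first.
  by apply/funext => p; exact: cons_rVK.
by rewrite product_measure1E// lte_mul_pinfty// ge0_fin_numE.
Qed.

HB.instance Definition _ := Measure_isSigmaFinite.Build _ _ _ lebesgue_rV_cons
  cons_sigma_finite.

End lebesgue_rV_cons.

(* Pinned down on boxes by [lebesgue_rV_box]. *)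
Fixpoint lebesgue_rV (R : realType) n :
    {sigma_finite_measure set 'rV[R]_n -> \bar R} :=
  match n with
  | 0%N => \d_(0 : 'rV[R]_0)
  | n'.+1 => lebesgue_rV_cons (lebesgue_rV R n')
  end.

Lemma lebesgue_rV_box (R : realType) n (A : 'I_n -> set (measurableTypeR R)) :
  (forall i, measurable (A i)) ->
  lebesgue_rV R n [set v | forall i, A i (v ord0 i)] =
  (\big[*%E/1%E]_(i < n) lebesgue_measure (A i))%E.
Proof.
elim: n A => [|n IH] A mA.
  by rewrite big_ord0 /= diracE mem_set// => -[].
rewrite big_ord_recl -(IH (fun i => A (lift ord0 i)))//.
rewrite /= /lebesgue_rV_cons /pushforward -product_measure1E//; last first.
  rewrite [X in measurable X](_ : _ = \bigcap_(i in [set: 'I_n])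
      ((fun v : 'rV[R]_n => v ord0 i) @^-1` A (lift ord0 i))); last first.
    by apply/seteqP; split => v /= Av i; [move=> _|]; exact: Av.
  apply: fin_bigcap_measurable => // i _.
  by rewrite -[X in measurable X]setTI; apply: measurable_coord => //; exact: mA.
congr (product_measure1 _ _ _); apply/seteqP; split => -[x v] /=.
  move=> Av; split => [|i].
    have := Av ord0; rewrite /cons_rV mxE; case: split_ordP => // j.
    by rewrite mxE.
  have := Av (lift ord0 i); rewrite /cons_rV mxE; case: split_ordP => j.
    by rewrite ord1 => /(congr1 val).
  by move=> /(congr1 val) /= [/val_inj ->].
move=> [Ax Av] i; rewrite /cons_rV mxE; case: split_ordP => j ij.
  rewrite mxE (_ : i = ord0)//; apply/val_inj; rewrite ij /=.
  by rewrite ord1.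
by rewrite (_ : i = lift ord0 j)//; exact/val_inj/(congr1 val ij).
Qed.

Section discrete_measure.
Local Open Scope ereal_scope.
Context d (T : measurableType d) (R : realType) (I : finType).
Variables (w : I -> R) (p : I -> T).

(* \sum_i w_i \d_(p_i) for nonnegative weights. Negative weights are cut off at
   0 only so that this is a measure for every [w]. *)
Definition discrete_measure (A : set T) : \bar R :=
  \sum_(i : I) (Num.max 0%R (w i))%:E * \d_(p i) A.

Let discrete0 : discrete_measure set0 = 0.
Proof. by rewrite /discrete_measure big1// => i _; rewrite measure0 mule0. Qed.

Let w_ge0 i : 0 <= (Num.max 0%R (w i))%:E.
Proof. by rewrite lee_fin le_max lexx. Qed.

Let discrete_ge0 A : 0 <= discrete_measure A.
Proof. by apply: sume_ge0 => i _; rewrite mule_ge0. Qed.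

Let discrete_sigma_additive : semi_sigma_additive discrete_measure.
Proof.
move=> F mF tF mUF; rewrite [X in X @ _ --> _](_ : _ =
  fun n => \sum_(i : I) (Num.max 0%R (w i))%:E *
    \sum_(0 <= k < n) \d_(p i) (F k)); last first.
  apply/funext => n; rewrite exchange_big; apply: eq_bigr => i _ /=.
  by rewrite ge0_sume_distrr.
apply: cvg_nnesum => i _.
  by apply: nearW => k; rewrite mule_ge0// sume_ge0.
by apply: cvgeZl => //; exact: measure_semi_sigma_additive.
Qed.

HB.instance Definition _ := isMeasure.Build _ _ _ discrete_measure
  discrete0 discrete_ge0 discrete_sigma_additive.

Let discrete_fin : fin_num_fun discrete_measure.
Proof.
by move=> A mA; apply/sum_fin_numP => i _ _; rewrite -EFinM.
Qed.

HB.instance Definition _ := Measure_isFinite.Build _ _ _ discrete_measure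
  discrete_fin.

End discrete_measure.

Section projections.
Context d1 d2 (T1 : measurableType d1) (T2 : measurableType d2).

HB.instance Definition _ :=
  isMeasurableFun.Build _ _ (T1 * T2)%type T1 fst measurable_fst.

HB.instance Definition _ :=
  isMeasurableFun.Build _ _ (T1 * T2)%type T2 snd measurable_snd.

End projections.

Section entropy_transport.
Local Open Scope ereal_scope.
Context {R : realType}.

Definition couplings d1 d2 (T1 : measurableType d1) (T2 : measurableType d2)
    (mu : {measure set T1 -> \bar R}) (nu : {measure set T2 -> \bar R}) :
    set (probability (T1 * T2)%type R) :=
  [set k | distribution k fst ≡μ mu /\ distribution k snd ≡μ nu].

(* [Radon_Nikodym] is only determined up to [m]-null, hence [P]-null, sets *)
Definition relative_entropy d (T : measurableType d) (P : probability T R)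
    (m : {sigma_finite_measure set T -> \bar R}) : \bar R :=
  if `[< P `<< m >] then
    \int[P]_z lne (Radon_Nikodym (charge_of_finite_measure P) m z)
  else +oo.

(* The library norm on ['rV[R]_n] is the sup norm, not the Euclidean one. *)
Definition sqdist n (x y : 'rV[R]_n) : R :=
  (\sum_(i < n) (x ord0 i - y ord0 i) ^+ 2)%R.

Definition transport_cost n (mu nu : {measure set 'rV[R]_n -> \bar R}) :
    \bar R :=
  ereal_inf [set \int[k]_z (2^-1 * sqdist z.1 z.2)%:E | k in couplings mu nu].

Definition entropic_cost n (mu nu : {measure set 'rV[R]_n -> \bar R})
    (gamma : probability ('rV[R]_n * 'rV[R]_n)%type R) (eps : R)
    (P : probability ('rV[R]_n * 'rV[R]_n)%type R) : \bar R :=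
  eps^-1%:E * transport_cost mu (distribution P fst) +
  eps^-1%:E * transport_cost nu (distribution P snd) +
  relative_entropy P gamma.

Definition minimizer d (T : measurableType d) (K : set (probability T R))
    (J : probability T R -> \bar R) (P : probability T R) : Prop :=
  K P /\ forall Q, K Q -> J P <= J Q.

(* Uniqueness is up to [≡μ], equality on measurable sets. The values of a
   library measure outside the sigma-algebra are irrelevant. *)
Definition unique_minimizer d (T : measurableType d)
    (K : set (probability T R)) (J : probability T R -> \bar R)
    (P : probability T R) : Prop :=
  minimizer K J P /\ forall Q, minimizer K J Q -> Q ≡μ P.

Definition weakly_cvg n (I : Type) (F : set_system I)
    (P : I -> probability ('rV[R]_n * 'rV[R]_n)%type R)
    (Q : probability ('rV[R]_n * 'rV[R]_n)%type R) : Prop :=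
  forall f : 'rV[R]_n * 'rV[R]_n -> R, continuous f ->
    (exists M : R, forall z, (`|f z| <= M)%R) ->
  \int[P i]_z (f z)%:E @[i --> F] --> \int[Q]_z (f z)%:E.

Definition has_density n (gamma : probability ('rV[R]_n * 'rV[R]_n)%type R)
    (rho : 'rV[R]_n * 'rV[R]_n -> R) : Prop :=
  measurable_fun [set: 'rV[R]_n * 'rV[R]_n] rho /\
  forall A, measurable A ->
    gamma A = \int[lebesgue_rV R n \x lebesgue_rV R n]_(z in A) (rho z)%:E.

End entropy_transport.

(* Main.v *)
Require Import Defs.
From HB Require Import structures.
From mathcomp Require Import all_boot all_order all_algebra.
From mathcomp Require Import all_classical all_reals all_analysis.
From mathcomp Require Import measurable_realfun giry.
From mathcomp Require Import ring lra.
Set Implicit Arguments.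
Unset Strict Implicit.
Unset Printing Implicit Defensive.
Import Order.TTheory GRing.Theory Num.Theory.
Import numFieldNormedType.Exports.
Local Open Scope classical_set_scope.
Local Open Scope ring_scope.

(** Write [G_e^ij (u, v) = exp (- (|x_i - u|^2 + |y_j - v|^2) / 2e)].  For any
potentials [alpha], [beta] and any bounded [f], the pairs
[(alpha, ln \sum_i exp alpha_i G_e^i)] and [(beta, ln \sum_j exp beta_j G_e^j)] are
feasible in the Kantorovich duals of the two transport problems (divided by [e]);
adding the Donsker-Varadhan inequality tested on [f] plus the two soft potentials
yields
  [I^e (P) >= \sum a alpha + \sum b beta + \int f dP
              - ln \sum_ij exp (alpha_i + beta_j) \int exp f G_e^ij d gamma].
Conversely, given a coupling [p] of the weights, mix with weights [p_ij] the normalized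
measures [G_e^ij gamma] restricted to the product of a cell around [x_i] and a cell
around [y_j]; transporting each cell to its centre shows that this competitor costs at
most [\sum p_ij ln (p_ij / \int_cell G_e^ij d gamma)].

By Laplace's method all these integrals are equivalent to
[(2 pi e)^d rho (x_i, y_j) exp f (x_i, y_j)].  When [alpha], [beta] are the Schroedinger
potentials of the discrete problem (critical points of its dual functional) and [p] its
solution, the bounds with [f = 0] agree up to [o(1)]: this is the energy expansion.
Replacing [f] by [t f] with [t] small and comparing the two bounds at the minimizer gives
[limsup \int f d pi^e <= \int f d pi^0], and the same for [- f]. *)

(** * Densities and relative entropy *)

(** The kernel is exp of minus the transport cost over [e]. Hence the logarithm of a sum of kernels
    satisfies the dual constraint, a positive sum dominating each of its terms, and the entropy of
    the competitor contains exactly minus the cost of moving each cell to its centre. Both bounds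
    reduce to Gaussian integrals in dimension [2 d], of size [e ^ d], whence [- d ln e]. For
    Schroedinger potentials the limiting weights have total mass 1, so for [f = 0] the logarithm in
    the lower bound tends to 0 after rescaling, and the bounds meet. For [t f] it tends to
    [t \int f d pi^0 + O (t ^ 2)] while the upper bound is unchanged; dividing by [t] identifies the
    limit from the values of the functional alone. The obstacle is integrability: transport costs
    and entropies may be infinite, so every test function is kept bounded, the soft potentials being
    lifted by a small [delta]. The Schroedinger potentials come from minimizing a functional of one
    potential only, invariant under adding constants and coercive modulo them. *)

Section density.
Local Open Scope ereal_scope.

Lemma measurable_lne (R : realType) : measurable_fun [set: \bar R] (@lne R).
Proof.
have -> : @lne R = fun x => if x <= 0 then -oo else er_map (@ln R) x.
  by apply/funext => -[r| |]//=; case: ifP.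
apply: measurable_fun_ifT => //=; last first.
  by apply: (@measurable_er_map _ (measurableTypeR R)); exact: measurable_ln.
exact: measurable_fun_lee.
Qed.

Context d (T : measurableType d) (R : realType).

Section with_density.
Variables (nu : {finite_measure set T -> \bar R})
  (mu : {sigma_finite_measure set T -> \bar R}) (h : T -> \bar R).
Hypothesis mh : measurable_fun setT h.
Hypothesis nuE : forall A, measurable A -> nu A = \int[mu]_(x in A) h x.

Lemma density_dominates : nu `<< mu.
Proof.
apply/null_content_dominatesP => A mA A0.
rewrite nuE//; apply: null_set_integral => //; exact: measurable_funTS.
Qed.

Lemma ae_eq_density_Radon_Nikodym :
  ae_eq mu setT (Radon_Nikodym (charge_of_finite_measure nu) mu) h.
Proof.
apply: integral_ae_eq => //.
- by apply: Radon_Nikodym_integrable; exact: density_dominates.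
- move=> A _ mA; rewrite -nuE// -Radon_Nikodym_integral//.
  exact: density_dominates.
Qed.

Lemma ge0_integral_density f : measurable_fun setT f -> (forall x, 0 <= f x) ->
  \int[nu]_x f x = \int[mu]_x (f x * h x).
Proof.
move=> mf f0; have numu := density_dominates.
have mRN : measurable_fun setT (Radon_Nikodym_SigmaFinite.f nu mu).
  exact: measurable_int (Radon_Nikodym_SigmaFinite.f_integrable _).
rewrite -(Radon_Nikodym_SigmaFinite.change_of_variables numu)//.
apply: ae_eq_integral => //.
- exact: emeasurable_funM.
- exact: emeasurable_funM.
apply: ae_eqe_mul2l.
apply: (ae_eq_trans _ ae_eq_density_Radon_Nikodym).
exact: ae_eq_Radon_Nikodym_SigmaFinite.
Qed.
End with_density.

(** Two densities agree off an [m]-null set, which is also [P]-null by domination, so an integral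
    against [P] does not depend on the choice of density. *)
Lemma relative_entropyE (P : probability T R)
    (m : {sigma_finite_measure set T -> \bar R}) (h : T -> \bar R) :
  measurable_fun setT h ->
  (forall A, measurable A -> P A = \int[m]_(x in A) h x) ->
  relative_entropy P m = \int[P]_x lne (h x).
Proof.
move=> mh PE; have Pm := density_dominates mh PE.
rewrite /relative_entropy asboolT//.
have mRN : measurable_fun setT (Radon_Nikodym (charge_of_finite_measure P) m).
  exact: measurable_int (Radon_Nikodym_integrable _).
apply: ae_eq_integral => //.
- by apply: measurableT_comp mRN; exact: measurable_lne.
- by apply: measurableT_comp mh; exact: measurable_lne.
apply: (@null_dominates_ae_eq _ _ _ _ _ m) => //.
by apply: ae_eq_comp; exact: ae_eq_density_Radon_Nikodym.
Qed.

(* No integrability is needed: both sides are [\int f^\+ - \int f^\-], with the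
   convention [+oo - +oo = -oo]. *)
Lemma le_integral_wide (mu : {measure set T -> \bar R}) (f g : T -> \bar R) :
  measurable_fun setT f -> measurable_fun setT g -> (forall x, f x <= g x) ->
  \int[mu]_x f x <= \int[mu]_x g x.
Proof.
move=> mf mg fg; rewrite integralE [leRHS]integralE; apply: leeB.
- apply: ge0_le_integral => //; [exact: measurable_funepos..|].
  by move=> x _; by apply: (@funepos_le T R setT) => //; rewrite inE.
- apply: ge0_le_integral => //; [exact: measurable_funeneg..|].
  by move=> x _; by apply: (@funeneg_le T R setT) => //; rewrite inE.
Qed.

End density.

(** * Gaussian integrals and Laplace's method *)

Section gaussian.
Context {R : realType}.

(** Left unnormalized, with peak value 1, so that its logarithm is exactly minus the transport cost
    over [e]; the missing normalization reappears as a power of [2 pi e] in the integrals. *)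
Definition gaussian n (e : R) (x v : 'rV[R]_n) : R :=
  expR (- (e^-1 * (2^-1 * sqdist x v))).

Lemma sqdist_ge0 n (x v : 'rV[R]_n) : 0 <= sqdist x v.
Proof. by apply: sumr_ge0 => i _; exact: sqr_ge0. Qed.

Lemma continuous_sqdist n (x : 'rV[R]_n) : continuous (sqdist x).
Proof.
apply: continuous_big => [|i _ v]; first exact: add_continuous.
have c : (fun w : 'rV[R]_n => x ord0 i - w ord0 i) @ v --> x ord0 i - v ord0 i.
  exact: (cvgB (cvg_cst _) (@coord_continuous _ _ _ ord0 i v)).
exact: (cvgM c c).
Qed.

Lemma measurable_sqdist d (T : measurableType d) n (f g : T -> 'rV[R]_n) :
  measurable_fun setT f -> measurable_fun setT g ->
  measurable_fun setT (fun t => sqdist (f t) (g t)).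
Proof.
move=> mf mg; apply: measurable_sum => i; apply: measurable_funX.
by apply: measurable_funB; apply: (measurableT_comp (measurable_coord i)).
Qed.

Lemma measurable_gaussian d (T : measurableType d) n e x (f : T -> 'rV[R]_n) :
  measurable_fun setT f -> measurable_fun setT (fun t => gaussian e x (f t)).
Proof.
move=> mf; rewrite /gaussian; apply: (measurableT_comp (@measurable_expR R)).
apply: measurableT_comp => //; apply: measurable_funM => //.
apply: measurable_funM => //.
exact: measurable_sqdist.
Qed.

Lemma gaussian_gt0 n e (x v : 'rV[R]_n) : 0 < gaussian e x v.
Proof. exact: expR_gt0. Qed.

Lemma gaussian_le1 n e (x v : 'rV[R]_n) : 0 < e -> gaussian e x v <= 1.
Proof.
move=> e0; rewrite -expR0 ler_expR oppr_le0 mulr_ge0 ?invr_ge0 ?(ltW e0)//.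
by rewrite mulr_ge0// sqdist_ge0.
Qed.

Lemma integral_gaussian1 (e m : R) : 0 < e ->
  (\int[lebesgue_measure]_t (expR (- (e^-1 * (2^-1 * (m - t) ^+ 2))))%:E =
   (Num.sqrt (2 * pi * e))%:E)%E.
Proof.
move=> e0; have s0 : Num.sqrt e != 0 by rewrite gt_eqF// sqrtr_gt0.
have p0 := normal_peak_gt0 s0.
have -> : Num.sqrt (2 * pi * e) = (normal_peak (Num.sqrt e))^-1.
  rewrite /normal_peak invrK sqr_sqrtr ?ltW//; congr Num.sqrt.
  ring.
rewrite -[RHS]mule1 -(integral_normal_pdf m (Num.sqrt e)) -ge0_integralZl//.
- apply: eq_integral => t _; rewrite normal_pdfE// -EFinM mulKf ?gt_eqF//.
  rewrite /normal_fun sqr_sqrtr ?ltW//; congr (expR _)%:E.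
  by field; rewrite gt_eqF.
- by apply/measurable_EFinP; exact: measurable_normal_pdf.
- by move=> t _; rewrite lee_fin normal_pdf_ge0.
- by rewrite lee_fin invr_ge0 ltW.
Qed.

Lemma sqdist_cons n (x : 'rV[R]_n.+1) (t : measurableTypeR R) (w : 'rV[R]_n) :
  sqdist x (cons_rV (t, w)) =
  (x ord0 ord0 - t) ^+ 2 + sqdist (\row_j x ord0 (lift ord0 j)) w.
Proof.
rewrite /sqdist big_ord_recl /cons_rV; congr (_ ^+ 2 + _).
  rewrite mxE; case: split_ordP => j; first by rewrite mxE.
  by move=> /(congr1 val).
apply: eq_bigr => i _; rewrite !mxE; case: split_ordP => j.
  by rewrite ord1 => /(congr1 val).
by move=> /(congr1 val) /= [/val_inj ->].
Qed.

Lemma integral_gaussian n (e : R) (x : 'rV[R]_n) : 0 < e ->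
  (\int[lebesgue_rV R n]_v (gaussian e x v)%:E =
   (Num.sqrt (2 * pi * e) ^+ n)%:E)%E.
Proof.
move=> e0; elim: n x => [|n IH] x.
  rewrite /= integral_dirac//; last first.
    by apply/measurable_EFinP; exact: measurable_gaussian.
  by rewrite diracT mul1e /gaussian /sqdist big_ord0 !mulr0 oppr0 expR0 expr0.
(* In dimension [n.+1] the Lebesgue measure is this pushforward by definition; exposing it allows
   the change of variables to [(t, w)], then Tonelli and the induction hypothesis. *)
rewrite /= (eq_measure_integral
  (pushforward (lebesgue_measure \x lebesgue_rV R n)%E (@cons_rV R n)))//.
  exact: measurable_cons_rV.
move=> mcons; rewrite ge0_integral_pushforward//=; last 2 first.
- by apply/measurable_EFinP; exact: measurable_gaussian.
- by move=> v _; rewrite lee_fin ltW// gaussian_gt0.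
rewrite preimage_setT fubini_tonelli1//; last 2 first.
- apply/measurable_EFinP; apply: measurable_gaussian.
  exact: measurable_cons_rV.
- by move=> v; rewrite lee_fin ltW// gaussian_gt0.
pose x' : 'rV[R]_n := \row_j x ord0 (lift ord0 j).
rewrite exprS EFinM -(integral_gaussian1 (x ord0 ord0) e0) -ge0_integralZr//.
- apply: eq_integral => t _; rewrite /fubini_F -(IH x') -ge0_integralZl//.
  + apply: eq_integral => w _; rewrite /= -EFinM -expRD /gaussian sqdist_cons.
    by rewrite !mulrDr opprD.
  + by apply/measurable_EFinP; exact: measurable_gaussian.
  + by move=> w _; rewrite lee_fin ltW// gaussian_gt0.
- apply/measurable_EFinP; apply: measurableT_comp => //.
  apply: measurableT_comp => //; apply: measurable_funM => //.
  apply: measurable_funM => //; apply: measurable_funX.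
  exact: measurable_funB.
Qed.

End gaussian.

(* The library equips [\x] with a sigma-finite structure only when both factors
   are sub-probabilities: a later instance shadows the general one. *)
Section product_sigma_finite.
Local Open Scope ereal_scope.
Context d1 d2 (T1 : measurableType d1) (T2 : measurableType d2) (R : realType).
Variables (m1 : {sigma_finite_measure set T1 -> \bar R})
  (m2 : {sigma_finite_measure set T2 -> \bar R}).

Definition product_measure : set (T1 * T2) -> \bar R := m1 \x m2.

HB.instance Definition _ := Measure.on product_measure.

Lemma product_measure_sigma_finite : sigma_finite setT product_measure.
Proof.
have /sigma_finiteP[F [FT ndF Foo]] := sigma_finiteT m1.
have /sigma_finiteP[G [GT ndG Goo]] := sigma_finiteT m2.
exists (fun k => F k `*` G k) => [|k].
  apply/esym; rewrite -subTset => -[u v] _.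
  have [i _ Fi] : (\bigcup_i F i) u by rewrite -FT.
  have [j _ Gj] : (\bigcup_i G i) v by rewrite -GT.
  exists (maxn i j) => //; split.
    exact: (subsetPset _ _ (ndF _ _ (leq_maxl i j))).
  exact: (subsetPset _ _ (ndG _ _ (leq_maxr i j))).
have [[mF Fk] [mG Gk]] := (Foo k, Goo k); split; first exact: measurableX.
by rewrite /product_measure product_measure1E// lte_mul_pinfty// ge0_fin_numE.
Qed.

HB.instance Definition _ := Measure_isSigmaFinite.Build _ _ _ product_measure
  product_measure_sigma_finite.

End product_sigma_finite.

Section laplace.
Context {R : realType} {n : nat}.
Local Notation V := 'rV[R]_n.
Local Notation leb2 := (lebesgue_rV R n \x lebesgue_rV R n)%E.

Definition gaussian2 (e : R) (w z : V * V) : R :=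
  gaussian e w.1 z.1 * gaussian e w.2 z.2.

Lemma gaussian2_gt0 e w z : 0 < gaussian2 e w z.
Proof. by rewrite mulr_gt0// gaussian_gt0. Qed.

Lemma gaussian2_le1 e w z : 0 < e -> gaussian2 e w z <= 1.
Proof.
by move=> e0; rewrite mulr_ile1 ?gaussian_le1// ltW// gaussian_gt0.
Qed.

Lemma measurable_gaussian2 e w : measurable_fun setT (gaussian2 e w).
Proof. by apply: measurable_funM; exact: measurable_gaussian. Qed.

Definition sqdist2 (w z : V * V) : R := sqdist w.1 z.1 + sqdist w.2 z.2.

Lemma gaussian2E e w z :
  gaussian2 e w z = expR (- (e^-1 * (2^-1 * sqdist2 w z))).
Proof. by rewrite /gaussian2 /gaussian -expRD -opprD -!mulrDr. Qed.

(** Neighbourhoods are those of the sup norm, distances are Euclidean: each squared coordinate is at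
    most the whole sum, so a Euclidean ball sits inside the sup ball of the same radius. *)
Lemma sqdist2_small_nbhs (w : V * V) (A : set (V * V)) : nbhs w A ->
  exists2 r : R, 0 < r & forall z, sqdist2 w z < r -> A z.
Proof.
case: w => x y /nbhs_ballP[r /= r0 rA]; exists (r ^+ 2) => [|[u v]].
  by rewrite exprn_gt0.
have sub (p q : V) : sqdist p q < r ^+ 2 -> ball p r q.
  move=> pq; split => // i j; rewrite ord1 {i} /ball/= -ltr_sqr ?nnegrE ?(ltW r0)//.
  rewrite real_normK ?num_real//; apply: le_lt_trans pq.
  rewrite /sqdist (bigD1 j)//= lerDl; apply: sumr_ge0 => k _.
  exact: sqr_ge0.
rewrite /sqdist2/= => s; apply: rA; split => /=; apply: sub.
- by apply: le_lt_trans s; rewrite lerDl sqdist_ge0.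
- by apply: le_lt_trans s; rewrite lerDr sqdist_ge0.
Qed.

(** Half of the exponent is spent on decay and half is kept for integrability: beyond [r] the spent
    half is at most [exp (- r / 4e)], which [exp t >= t] bounds by [4e / r], and the kept half is
    the kernel of parameter [2 * e]. *)
Lemma gaussian2_tail e w z r : 0 < e -> 0 < r -> r <= sqdist2 w z ->
  gaussian2 e w z <= 4 * e / r * gaussian2 (2 * e) w z.
Proof.
move=> e0 r0 rz; set t := r / (4 * e).
have t0 : 0 < t by rewrite divr_gt0// mulr_gt0.
have -> : 4 * e / r = t^-1 by rewrite /t invf_div.
apply: (@le_trans _ _ (expR (- t) * gaussian2 (2 * e) w z)).
  rewrite !gaussian2E -expRD ler_expR -opprD lerN2.
  rewrite -subr_ge0 (_ : _ - _ = (4 * e)^-1 * (sqdist2 w z - r)).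
    by rewrite mulr_ge0 ?subr_ge0// invr_ge0 mulr_ge0// ltW.
  by rewrite /t; field; rewrite gt_eqF.
rewrite ler_wpM2r ?(ltW (gaussian2_gt0 _ _ _))// expRN.
by rewrite lef_pV2 ?posrE ?expR_gt0// (le_trans _ (expR_ge1Dx _))// lerDr.
Qed.

Lemma integral_gaussian2 (e : R) (w : V * V) : 0 < e ->
  (\int[leb2]_z (gaussian2 e w z)%:E = ((2 * pi * e) ^+ n)%:E)%E.
Proof.
case: w => x y e0; rewrite fubini_tonelli1//; last 2 first.
- apply/measurable_EFinP; apply: measurable_funM; exact: measurable_gaussian.
- by move=> v; rewrite lee_fin mulr_ge0// ltW// gaussian_gt0.
rewrite -[2 * pi * e]sqr_sqrtr ?mulr_ge0 ?pi_ge0 ?ltW// -exprM mulnC muln2 -addnn.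
rewrite exprD EFinM.
rewrite -{1}(integral_gaussian x e0) -(integral_gaussian y e0) -ge0_integralZr//.
- apply: eq_integral => t _; rewrite /fubini_F -ge0_integralZl//.
  + by apply/measurable_EFinP; exact: measurable_gaussian.
  + by move=> w _; rewrite lee_fin ltW// gaussian_gt0.
  + by rewrite lee_fin ltW// gaussian_gt0.
- by apply/measurable_EFinP; exact: measurable_gaussian.
- by move=> w _; rewrite lee_fin ltW// gaussian_gt0.
- by apply: integral_ge0 => w _; rewrite lee_fin ltW// gaussian_gt0.
Qed.

Section bounded.
Variables (g : V * V -> R) (M : R) (w : V * V).
Hypothesis mg : measurable_fun setT g.
Hypothesis g0 : forall z, 0 <= g z.
Hypothesis gM : forall z, g z <= M.
Hypothesis gc : {for w, continuous g}.

(** Near [w] the function [g] moves by less than [eta]; away from [w] the difference is at most [M]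
    and the Gaussian tail costs a factor of order [e]. Along the way the integral is shown to be
    finite. *)
Lemma laplace_bound (eta : R) : 0 < eta -> exists2 C, 0 <= C &
  forall e, 0 < e -> exists2 I : R,
    (\int[leb2]_z (g z * gaussian2 e w z)%:E = I%:E)%E &
    `|((2 * pi * e) ^+ n)^-1 * I - g w| <= eta + C * e.
Proof.
move=> eta0.
have [r r0 rP] : exists2 r : R, 0 < r &
    forall z, sqdist2 w z < r -> `|g w - g z| < eta.
  apply: sqdist2_small_nbhs.
  by move/cvgrPdist_lt : gc; exact.
have M0 : 0 <= M by rewrite (le_trans (g0 w)).
(* [4 / r] is the tail constant, and [2 ^+ n] is the ratio of the Gaussian masses at the parameters
   [2 * e] and [e]. *)
exists (M * (4 / r) * 2 ^+ n) => [|e e0].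
  by rewrite !mulr_ge0 ?invr_ge0 ?exprn_ge0// ltW.
have e20 : 0 < 2 * e by rewrite mulr_gt0.
have pe : 0 < 2 * pi * e by rewrite !mulr_gt0// pi_gt0.
have B0 : 0 <= M * (4 * e / r).
  by rewrite mulr_ge0// divr_ge0 ?mulr_ge0 ?(ltW e0) ?(ltW r0).
have ptw z : `|g z - g w| * gaussian2 e w z <=
    eta * gaussian2 e w z + M * (4 * e / r) * gaussian2 (2 * e) w z.
  have G0 e' := ltW (gaussian2_gt0 e' w z).
  have [zr|zr] := ltP (sqdist2 w z) r.
    rewrite -[leLHS]addr0 lerD//.
      by rewrite ler_wpM2r// distrC ltW// rP.
    exact: mulr_ge0.
  rewrite -[leLHS]add0r lerD//; first by rewrite mulr_ge0// ltW.
  rewrite -mulrA ler_pM//; last exact: gaussian2_tail.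
  rewrite ler_norml; apply/andP; split.
    by rewrite lerNl opprB (le_trans _ (gM w))// lerBlDr lerDl.
  by rewrite (le_trans _ (gM z))// lerBlDr lerDl.
have mG e' c : measurable_fun setT (fun z => (c * gaussian2 e' w z)%:E).
  by apply/measurable_EFinP; apply: measurable_funM => //; exact: measurable_gaussian2.
have mgG : measurable_fun setT (fun z => (g z * gaussian2 e w z)%:E).
  by apply/measurable_EFinP; apply: measurable_funM => //; exact: measurable_gaussian2.
have IG e' c : 0 < e' -> 0 <= c ->
  (\int[leb2]_z (c * gaussian2 e' w z)%:E = (c * (2 * pi * e') ^+ n)%:E)%E.
  move=> e'0 c0; under eq_integral do rewrite EFinM.
  rewrite ge0_integralZl_EFin//; first by rewrite integral_gaussian2.
    by move=> z _; rewrite lee_fin ltW// gaussian2_gt0.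
  by apply/measurable_EFinP; exact: measurable_gaussian2.
set I := (\int[leb2]_z (g z * gaussian2 e w z)%:E)%E.
have I0 : (0 <= I)%E.
  by apply: integral_ge0 => z _; rewrite lee_fin mulr_ge0// ltW// gaussian2_gt0.
have IM : (I <= (M * (2 * pi * e) ^+ n)%:E)%E.
  rewrite -IG//; apply: ge0_le_integral => //.
  - by move=> z _; rewrite lee_fin mulr_ge0// ltW// gaussian2_gt0.
  - by move=> z _; rewrite lee_fin ler_wpM2r// ltW// gaussian2_gt0.
have Ifin : I \is a fin_num.
  by rewrite ge0_fin_numE// (le_lt_trans IM)// ltry.
exists (fine I); first by rewrite fineK.
set B := (M * (4 * e / r) * (2 * pi * (2 * e)) ^+ n).
have up : fine I <= (g w + eta) * (2 * pi * e) ^+ n + B.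
  rewrite -lee_fin fineK// EFinD -!IG// ?addr_ge0// ?(ltW eta0)//.
  rewrite -ge0_integralD//.
  - apply: ge0_le_integral => //.
    + by move=> z _; rewrite lee_fin mulr_ge0// ltW// gaussian2_gt0.
    + exact: emeasurable_funD.
    + move=> z _; rewrite -EFinD lee_fin mulrDl -addrA -lerBlDl -mulrBl.
      apply: le_trans (ptw z).
      by rewrite ler_wpM2r ?ler_norm// ltW// gaussian2_gt0.
  - by move=> z _; rewrite lee_fin mulr_ge0 ?addr_ge0// ltW// gaussian2_gt0.
  - by move=> z _; rewrite lee_fin mulr_ge0// ltW// gaussian2_gt0.
have lo : g w * (2 * pi * e) ^+ n <= fine I + (eta * (2 * pi * e) ^+ n + B).
  rewrite -lee_fin 2!EFinD fineK// -!IG// ?(ltW eta0)//.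
  rewrite -[X in (_ <= _ + X)%E]ge0_integralD//; last 2 first.
  - by move=> z _; rewrite lee_fin mulr_ge0// ltW// gaussian2_gt0.
  - by move=> z _; rewrite lee_fin mulr_ge0// ltW// gaussian2_gt0.
  rewrite -ge0_integralD//; last 3 first.
  - by move=> z _; rewrite lee_fin mulr_ge0// ltW// gaussian2_gt0.
  - by move=> z _; rewrite -EFinD lee_fin addr_ge0// mulr_ge0// ltW// gaussian2_gt0.
  - exact: emeasurable_funD.
  apply: ge0_le_integral => //.
  - by move=> z _; rewrite lee_fin mulr_ge0// ltW// gaussian2_gt0.
  - by apply: emeasurable_funD => //; exact: emeasurable_funD.
  - move=> z _; rewrite -!EFinD lee_fin -lerBlDl -mulrBl.
    apply: le_trans (ptw z).
    by rewrite ler_wpM2r ?(ltW (gaussian2_gt0 _ _ _))// distrC ler_norm.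
set N := (2 * pi * e) ^+ n.
have N0 : 0 < N by rewrite exprn_gt0.
have BE : B = M * (4 / r) * 2 ^+ n * e * N.
  rewrite /B /N (_ : 2 * pi * (2 * e) = 2 * (2 * pi * e)); last by ring.
  by rewrite exprMn; ring.
rewrite ler_norml; apply/andP; split.
  rewrite -subr_ge0 opprK.
  rewrite [X in 0 <= X](_ : _ = N^-1 * (fine I + (eta * N + B) - g w * N)).
    by rewrite mulr_ge0 ?invr_ge0 ?(ltW N0)// subr_ge0.
  by rewrite BE; field; rewrite !gt_eqF.
rewrite -subr_ge0.
rewrite [X in 0 <= X](_ : _ = N^-1 * ((g w + eta) * N + B - fine I)).
  by rewrite mulr_ge0 ?invr_ge0 ?(ltW N0)// subr_ge0.
by rewrite BE; field; rewrite !gt_eqF.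
Qed.

Lemma laplace_cvg :
  (e ^+ n)^-1 * \int[leb2]_z (g z * gaussian2 e w z) @[e --> 0^'+] -->
  (2 * pi) ^+ n * g w.
Proof.
have P0 : 0 < (2 * pi : R) ^+ n by rewrite exprn_gt0// mulr_gt0// pi_gt0.
suff L : ((2 * pi * e) ^+ n)^-1 * \int[leb2]_z (g z * gaussian2 e w z)
    @[e --> 0^'+] --> g w.
  have := cvgM (cvg_cst ((2 * pi : R) ^+ n)) L.
  move=> /(_ _ _ _); apply: cvg_trans; apply: near_eq_cvg; near=> e.
  by rewrite /= (exprMn _ (2 * pi) e) invfM mulrA mulVKf// gt_eqF.
apply/cvgrPdist_le => eta eta0.
have eta20 : 0 < eta / 2 by rewrite divr_gt0.
have [C C0 CP] := laplace_bound eta20.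
near=> e.
have e0 : 0 < e by [].
have [I IE /le_trans] := CP _ e0.
rewrite /Rintegral IE /= distrC; apply.
rewrite [leRHS]splitr lerD2l.
(* [C] may be 0, whereas one can divide by [C + 1]. *)
have Ce : C * e <= (C + 1) * e by rewrite mulrDl lerDl mul1r ltW.
rewrite (le_trans Ce)// mulrC -ler_pdivlMr ?ltr_wpDl//.
near: e; apply: nbhs_right_le; rewrite divr_gt0// ltr_wpDl//.
Unshelve. all: by end_near. Qed.

End bounded.

(** Laplace's method for the product [h \* rho]. The weight [h] will be [exp f] in the lower bound
    and the indicator of a product of cells in the upper one. *)
Lemma laplace_density_cvg (gamma : probability (V * V)%type R)
    (rho h : V * V -> R) (M N : R) (w : V * V) :
  has_density gamma rho -> (forall z, 0 <= rho z) -> (forall z, rho z <= M) ->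
  measurable_fun setT h -> (forall z, 0 <= h z) -> (forall z, h z <= N) ->
  {for w, continuous rho} -> {for w, continuous h} ->
  (e ^+ n)^-1 * \int[gamma]_z (h z * gaussian2 e w z) @[e --> 0^'+] -->
  (2 * pi) ^+ n * rho w * h w.
Proof.
move=> [mrho gammaE] rho0 rhoM mh h0 hN rhoc hc.
have : (e ^+ n)^-1 * \int[leb2]_z ((h z * rho z) * gaussian2 e w z)
    @[e --> 0^'+] --> (2 * pi) ^+ n * (h w * rho w).
  apply: (@laplace_cvg (h \* rho) (N * M)).
  - exact: measurable_funM.
  - by move=> z; exact: mulr_ge0.
  - by move=> z; exact: ler_pM.
  - exact: cvgM hc rhoc.
rewrite mulrAC -mulrA; apply: cvg_trans; apply: near_eq_cvg; near=> e.
congr (_ * fine _).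
rewrite (@ge0_integral_density _ _ _ gamma
  (product_measure (lebesgue_rV R n) (lebesgue_rV R n)) (EFin \o rho))//.
- apply: eq_integral => z _; rewrite -EFinM; congr EFin; ring.
- exact/measurable_EFinP.
- apply/measurable_EFinP; apply: measurable_funM => //.
  exact: measurable_gaussian2.
- by move=> z; rewrite lee_fin mulr_ge0// ltW// gaussian2_gt0.
Unshelve. all: by end_near. Qed.

End laplace.

(** * The dual lower bound *)

Section donsker_varadhan.
Context d (T : measurableType d) (R : realType).

Lemma bounded_integrable (P : probability T R) (f : T -> R) (K : R) :
  measurable_fun setT f -> (forall x, `|f x| <= K) ->
  P.-integrable setT (EFin \o f).
Proof.
move=> mf fK; apply: measurable_bounded_integrable => //.
  by rewrite [X in (X < _)%E](@probability_setT _ _ _ P) ltry.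
exists K; split; first exact: num_real.
by move=> M KM x _; apply: le_trans (fK x) _; exact: ltW.
Qed.

Lemma EFin_Rintegral (P : probability T R) (f : T -> R) (K : R) :
  measurable_fun setT f -> (forall x, `|f x| <= K) ->
  (\int[P]_x (f x)%:E = (\int[P]_x f x)%:E)%E.
Proof.
move=> mf fK; rewrite fineK//; apply: integrable_fin_num => //.
exact: bounded_integrable fK.
Qed.

Lemma Rintegral_prob_cst (P : probability T R) (c : R) : \int[P]_x c = c.
Proof.
by rewrite Rintegral_cst// [X in fine X](@probability_setT _ _ _ P) mulr1.
Qed.

(** If the integral vanished, the function would vanish almost everywhere; being positive
    everywhere, it would make the whole space a null set. *)
Lemma Rintegral_gt0 (P : probability T R) (h : T -> R) (K : R) :
  measurable_fun setT h -> (forall z, 0 < h z) -> (forall z, `|h z| <= K) ->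
  0 < \int[P]_z h z.
Proof.
move=> mh h0 hK; rewrite lt_neqAle Rintegral_ge0 ?andbT; last first.
  by move=> z _; exact: ltW.
apply/negP => /eqP; rewrite /Rintegral => /esym I0.
have : (\int[P]_z `|(h z)%:E|)%E = 0%E.
  under eq_integral do rewrite gee0_abs ?lee_fin ?(ltW (h0 _))//.
  by rewrite (EFin_Rintegral P mh hK) [X in X%:E]I0.
move=> /(ae_eq_integral_abs _ measurableT); case; first exact/measurable_EFinP.
move=> N [mN N0 hN].
have : (P setT <= P N)%E.
  apply: le_measure; rewrite ?inE// => z _; apply: hN => /= /(_ I) [] hz.
  by have := h0 z; rewrite hz ltxx.
by rewrite N0 [X in (X <= _)%E](@probability_setT _ _ _ P) lee_fin ler10.
Qed.

Lemma donsker_varadhan (P gamma : probability T R) (phi : T -> R) (K : R) :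
  measurable_fun setT phi -> (forall x, `|phi x| <= K) ->
  ((\int[P]_x phi x - ln (\int[gamma]_x expR (phi x)))%:E <=
   relative_entropy P gamma)%E.
Proof.
move=> mphi phiK; have [Pg|nPg] := pselect (P `<< gamma); last first.
  by rewrite /relative_entropy asboolF ?leey.
pose h := Radon_Nikodym_SigmaFinite.f P gamma.
have h0 x : (0 <= h x)%E by exact: Radon_Nikodym_SigmaFinite.f_ge0.
have hfin x : h x \is a fin_num by exact: Radon_Nikodym_SigmaFinite.f_fin_num.
have mh : measurable_fun setT h.
  exact: measurable_int (Radon_Nikodym_SigmaFinite.f_integrable _).
have hE A : measurable A -> P A = (\int[gamma]_(x in A) h x)%E.
  by move=> mA; exact: Radon_Nikodym_SigmaFinite.f_integral.
rewrite (relative_entropyE mh hE).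
have mhr : measurable_fun setT (fine \o h).
  by apply: measurableT_comp => //; exact: measurable_fine.
(* The density is replaced by 1 where it vanishes, on a [P]-null set, so that its logarithm becomes
   real-valued. *)
pose h1 x := if fine (h x) == 0 then 1 else fine (h x).
have mh0 : measurable [set x | fine (h x) == 0].
  rewrite (_ : mkset _ = (fine \o h) @^-1` [set 0]).
    by rewrite -[X in measurable X]setTI; exact: mhr.
  by apply/seteqP; split => x /= /eqP.
have mh1 : measurable_fun setT h1.
  apply: measurable_fun_ifT => //; apply: (measurable_fun_bool true).
  by rewrite setTI.
have h10 x : 0 < h1 x.
  rewrite /h1; case: ifPn => // hx; rewrite lt_neqAle eq_sym hx.
  exact: fine_ge0.
have Ph0 : P [set x | fine (h x) == 0] = 0%E.
  rewrite hE//; apply: integral0_eq => x /= /eqP hx.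
  by rewrite -[h x]fineK// hx.
have -> : (\int[P]_x lne (h x) = \int[P]_x (ln (h1 x))%:E)%E.
  apply: ae_eq_integral => //.
  - by apply: measurableT_comp mh; exact: measurable_lne.
  - by apply/measurable_EFinP; apply: measurableT_comp mh1; exact: measurable_ln.
  exists [set x | fine (h x) == 0]; split => // x /= hx; apply: contrapT => hx0.
  apply: hx => _; rewrite -(lne_EFin (h10 x)) /h1 ifN ?fineK//.
  exact/negP.
set Z := \int[gamma]_x expR (phi x).
have mexp : measurable_fun setT (fun x => expR (phi x)) by exact: measurableT_comp mphi.
have expK x : `|expR (phi x)| <= expR K.
  by rewrite ger0_norm ?expR_ge0// ler_expR (le_trans (ler_norm _)).
have Z0 : 0 < Z by apply: Rintegral_gt0 expK => // x; exact: expR_gt0.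
(* [w] is the density with respect to [gamma] of the measure tilted by [phi], and [k] compares that
   measure with [P]. *)
pose w x := expR (phi x) / Z; pose k x := w x / h1 x.
have w0 x : 0 <= w x by rewrite divr_ge0 ?expR_ge0// ltW.
have k0 x : 0 <= k x by rewrite divr_ge0// ltW.
have mw : measurable_fun setT w.
  by apply: measurable_funM => //; exact: measurableT_comp mphi.
have mk : measurable_fun setT k.
  have -> : k = fun x => w x * expR (- ln (h1 x)).
    by apply/funext => x; rewrite expRN lnK ?posrE.
  apply: measurable_funM => //; apply: measurableT_comp => //.
  apply: measurableT_comp => //; apply: measurableT_comp mh1.
  exact: measurable_ln.
have ephi : (\int[gamma]_x (expR (phi x))%:E = Z%:E)%E.
  exact: EFin_Rintegral expK.
(* An inequality only: the tilted measure may charge the set where [h] vanishes, which [P] does not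
   see. *)
have Ik : (\int[P]_x (k x)%:E <= 1)%E.
  rewrite (ge0_integral_density mh hE)//; last exact/measurable_EFinP.
  apply: (@le_trans _ _ (\int[gamma]_x (w x)%:E)%E).
    apply: ge0_le_integral => //.
    - by move=> x _; rewrite mule_ge0// lee_fin.
    - by apply: emeasurable_funM => //; exact/measurable_EFinP.
    - exact/measurable_EFinP.
    - move=> x _; rewrite -[h x]fineK// -EFinM lee_fin /k /h1.
      case: ifPn => [/eqP ->|hx]; first by rewrite mulr0.
      by rewrite divfK.
  rewrite /w; under eq_integral do rewrite EFinM.
  rewrite ge0_integralZr//.
  - by rewrite ephi -EFinM divff// gt_eqF.
  - by apply/measurable_EFinP; exact: measurableT_comp mphi.
  - by rewrite lee_fin invr_ge0 ltW.
(* [ln h >= phi - ln Z + 1 - exp (phi - ln Z) / h], and the last term has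
   [P]-integral at most [1]; this avoids any integrability assumption on [ln h]. *)
pose B x := phi x - ln Z + 1.
have mB : measurable_fun setT B.
  by apply: measurable_funD => //; exact: measurable_funB.
have BK x : `|B x| <= K + `|ln Z| + 1.
  by rewrite (le_trans (ler_normD _ _))// normr1 lerD// (le_trans (ler_normB _ _))// lerD.
have ki : P.-integrable setT (EFin \o k).
  apply/integrableP; split; first exact/measurable_EFinP.
  under eq_integral do rewrite gee0_abs ?lee_fin//.
  by rewrite (le_lt_trans Ik)// ltry.
have Bi := bounded_integrable P mB BK.
have phii := bounded_integrable P mphi phiK.
apply: (@le_trans _ _ (\int[P]_x (B x - k x)%:E)%E); last first.
  apply: le_integral_wide.
  - by apply/measurable_EFinP; exact: measurable_funB.
  - by apply/measurable_EFinP; apply: measurableT_comp mh1; exact: measurable_ln.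
  - move=> x; rewrite lee_fin /B.
    have := expR_ge1Dx (phi x - ln Z - ln (h1 x)).
    have -> : expR (phi x - ln Z - ln (h1 x)) = k x.
      by rewrite !expRB !lnK ?posrE.
    lra.
under eq_integral do rewrite EFinB.
rewrite integralB_EFin// (EFin_Rintegral P mB BK).
have -> : \int[P]_x B x = \int[P]_x phi x - ln Z + 1.
  rewrite /B RintegralD//; last 2 first.
  - apply: (@bounded_integrable _ _ (K + `|ln Z|)); first exact: measurable_funB.
    by move=> x; rewrite (le_trans (ler_normB _ _))// lerD.
  - exact: (@bounded_integrable _ _ `|1|).
  rewrite RintegralB//; last exact: (@bounded_integrable _ _ `|ln Z|).
  by rewrite !Rintegral_prob_cst.
rewrite leeBrDr ?ge0_fin_numE; last 2 first.
- by rewrite (le_lt_trans Ik)// ltry.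
- by apply: integral_ge0 => x _; rewrite lee_fin.
by rewrite [leRHS]EFinD leeD2l.
Qed.

End donsker_varadhan.

Section discrete.
Context d (T : measurableType d) (R : realType).
Local Open Scope ereal_scope.

Lemma discrete_measureE (I : finType) (w : I -> R) (p : I -> T) (A : set T) :
  (forall i, 0 <= w i)%R ->
  discrete_measure w p A = \sum_(i : I) (w i * \1_A (p i))%:E.
Proof.
move=> w0; apply: eq_bigr => i _.
by rewrite (max_idPr (w0 i)) diracE indicE -EFinM.
Qed.

Lemma discrete_measure1 (I : finType) (w : I -> R) (p : I -> T) (i : I) :
  (forall i, 0 <= w i)%R -> injective p ->
  discrete_measure w p [set p i] = (w i)%:E.
Proof.
move=> w0 pinj; rewrite discrete_measureE// (bigD1 i)//= big1 => [|j ji].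
  by rewrite adde0 indicE mem_set// mulr1.
by rewrite indicE memNset ?mulr0// => /= /pinj /eqP; apply/negP.
Qed.
End discrete.

Lemma measurable_set1_rV (R : realType) n (v : 'rV[R]_n) : measurable [set v].
Proof.
rewrite (_ : [set v] = \bigcap_(i in [set: 'I_n])
    ((fun w : 'rV[R]_n => w ord0 i) @^-1` [set v ord0 i])).
  apply: fin_bigcap_measurable => // i _.
  by rewrite -[X in measurable X]setTI; apply: measurable_coord.
apply/seteqP; split => [w -> //|w vw]; apply/rowP => i; exact: vw.
Qed.

Lemma Rintegral_sum d (T : measurableType d) (R : realType)
    (P : {measure set T -> \bar R}) (I : finType) (h : I -> T -> R) :
  (forall i, P.-integrable setT (EFin \o h i)) ->
  \int[P]_z (\sum_i h i z) = \sum_i \int[P]_z (h i z).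
Proof.
move=> hi; rewrite /Rintegral sum_fine => [|i _]; last first.
  by apply: integrable_fin_num => //; exact: hi.
congr fine; rewrite -integral_sum//; apply: eq_integral => z _.
by rewrite -sumEFin.
Qed.

(** * Bounds on the transport cost by couplings and by dual potentials *)

Section transport_duality.
Context {R : realType} {n : nat}.
Local Notation V := 'rV[R]_n.

(** The joint law of [(S, X)] is an admissible plan. A plan can thus be given by a random variable
    [S] on the same space, later the centre of the cell containing [X]. *)
Lemma transport_cost_le d (T : measurableType d) (P : probability T R)
    (S X : {mfun T >-> V}) (mu : {measure set V -> \bar R}) :
  distribution P S ≡μ mu ->
  (transport_cost mu (distribution P X) <=
   \int[P]_t (2^-1 * sqdist (S t) (X t))%:E)%E.
Proof.
move=> Smu; have mSX : measurable_fun setT (fun t => (S t, X t)).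
  exact: measurable_fun_pair.
pose SX : {mfun T >-> (V * V)%type} := mfun_Sub (mem_set mSX).
apply: ereal_inf_lbound; exists (distribution P SX).
  split => A mA; last by [].
  by rewrite -Smu.
rewrite ge0_integral_distribution//.
  apply/measurable_EFinP; apply: measurable_funM => //.
  exact: measurable_sqdist.
by move=> z; rewrite lee_fin mulr_ge0// sqdist_ge0.
Qed.

(** Weak Kantorovich duality: the dual constraint is integrated against an arbitrary coupling.
    Boundedness of the potentials makes the dual side finite even when the cost of the coupling is
    not. *)
Lemma transport_cost_ge N (a : 'I_N -> R) (x : 'I_N -> V)
    (Q : probability V R) (e K : R) (alpha : 'I_N -> R) (psi : V -> R) :
  (forall i, 0 <= a i) -> \sum_i a i = 1 -> injective x -> 0 < e ->
  measurable_fun setT psi -> (forall v, `|psi v| <= K) ->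
  (forall i v, alpha i - psi v <= e^-1 * (2^-1 * sqdist (x i) v)) ->
  ((\sum_i a i * alpha i - \int[Q]_v psi v)%:E <=
   e^-1%:E * transport_cost (discrete_measure a x) Q)%E.
Proof.
move=> a0 a1 xinj e0 mpsi psiK dual.
rewrite lee_pdivlMl// -EFinM; apply: le_ereal_inf_tmp => _ [k [k1 k2] <-].
(* [alpha] extended by [- K] off the support: dual feasibility then holds everywhere. *)
pose A v := \sum_i (alpha i + K) * \1_[set x i] v - K.
have mx i : measurable [set x i] by exact: measurable_set1_rV.
have AE i : A (x i) = alpha i.
  rewrite /A (bigD1 i)//= big1 => [|j ji].
    by rewrite indicE mem_set// mulr1 addr0 addrK.
  by rewrite indicE memNset ?mulr0// => /= /xinj /eqP; rewrite eq_sym; apply/negP.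
have ANE v : (forall i, v <> x i) -> A v = - K.
  move=> vx; rewrite /A big1 ?sub0r// => i _.
  by rewrite indicE memNset ?mulr0// => /=; exact: vx.
have mA1 i : measurable_fun setT (fun v => (alpha i + K) * \1_[set x i] v).
  by apply: measurable_funM => //; exact: measurable_indic.
have mA : measurable_fun setT A.
  by apply: measurable_funB => //; exact: measurable_sum.
have AB v : `|A v| <= \sum_i `|alpha i + K| + `|K|.
  rewrite (le_trans (ler_normB _ _))// lerD//.
  rewrite (le_trans (ler_norm_sum _ _ _))// ler_sum// => i _.
  by rewrite normrM ler_piMr// indicE; case: (_ \in _); rewrite ?normr1 ?normr0.
have ptw z : A z.1 - psi z.2 <= e^-1 * (2^-1 * sqdist z.1 z.2).
  have [[i zi]|zN] := pselect (exists i, z.1 = x i).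
    by rewrite zi AE.
  rewrite ANE => [|i zi]; last by apply: zN; exists i.
  apply: (@le_trans _ _ 0).
    by rewrite subr_le0; have := psiK z.2; rewrite ler_norml => /andP[].
  by rewrite mulr_ge0 ?invr_ge0 ?(ltW e0)// mulr_ge0// sqdist_ge0.
have mA1' : measurable_fun setT (fun z : V * V => A z.1).
  exact: measurableT_comp mA measurable_fst.
have mpsi2 : measurable_fun setT (fun z : V * V => psi z.2).
  exact: measurableT_comp mpsi measurable_snd.
have IA : \int[k]_z A z.1 = \sum_i a i * alpha i.
  have int1 i : k.-integrable setT
      (EFin \o (fun z : V * V => (alpha i + K) * \1_[set x i] z.1)).
    apply: (@bounded_integrable _ _ _ _ _ `|alpha i + K|).
      exact: (measurableT_comp (mA1 i) measurable_fst).
    move=> z; rewrite normrM ler_piMr// indicE.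
    by case: (_ \in _); rewrite ?normr1 ?normr0.
  rewrite /A RintegralB//; last 2 first.
  - apply: (@bounded_integrable _ _ _ _ _ (\sum_i `|alpha i + K|)).
      apply: measurable_sum => i; exact: (measurableT_comp (mA1 i) measurable_fst).
    move=> z; rewrite (le_trans (ler_norm_sum _ _ _))// ler_sum// => i _.
    by rewrite normrM ler_piMr// indicE; case: (_ \in _); rewrite ?normr1 ?normr0.
  - exact: (@bounded_integrable _ _ _ _ _ `|K|).
  rewrite Rintegral_sum// Rintegral_prob_cst.
  transitivity (\sum_i (alpha i + K) * a i - K).
    congr (_ - _); apply: eq_bigr => i _.
    rewrite RintegralZl//; last first.
      apply: (@bounded_integrable _ _ _ _ _ 1).
        apply: (measurableT_comp _ measurable_fst).
        exact: measurable_indic.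
      by move=> z; rewrite indicE; case: (_ \in _); rewrite ?normr1 ?normr0.
    congr (_ * _); rewrite /Rintegral.
    rewrite -[X in fine X]/(\int[k]_z (\1_(fst @^-1` [set x i]) z)%:E)%E.
    rewrite integral_indic//; last first.
      by rewrite -[X in measurable X]setTI; exact: measurable_fst.
    by rewrite setIT [X in fine X](k1 _ (mx i)) [X in fine X]discrete_measure1.
  under eq_bigr do rewrite mulrDl.
  rewrite big_split/= -mulr_sumr a1 mulr1 addrK.
  by apply: eq_bigr => i _; rewrite mulrC.
have Ipsi : \int[k]_z psi z.2 = \int[Q]_v psi v.
  congr fine.
  transitivity (\int[distribution k snd]_v (psi v)%:E)%E; last first.
    by apply: eq_measure_integral => B mB _; exact: k2.
  rewrite integral_distribution//; first exact/measurable_EFinP.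
  exact: (@bounded_integrable _ _ _ _ _ K).
have IU : \int[k]_z (A z.1 - psi z.2) = \sum_i a i * alpha i - \int[Q]_v psi v.
  rewrite -IA -Ipsi RintegralB//.
  - exact: bounded_integrable (fun z => AB z.1).
  - exact: bounded_integrable (fun z => psiK z.2).
have mU : measurable_fun setT (fun z : V * V => A z.1 - psi z.2).
  exact: measurable_funB.
have UB (z : V * V) : `|A z.1 - psi z.2| <= \sum_i `|alpha i + K| + `|K| + K.
  by rewrite (le_trans (ler_normB _ _))// lerD.
rewrite -IU EFinM -(EFin_Rintegral _ mU UB) -integralZl//; last first.
  exact: bounded_integrable UB.
apply: le_integral_wide.
- by apply/measurable_EFinP; exact: measurable_funM.
- by apply/measurable_EFinP; apply: measurable_funM => //; exact: measurable_sqdist.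
- by move=> z; rewrite -EFinM lee_fin mulrC -ler_pdivlMr// mulrC.
Qed.

End transport_duality.

Lemma sum1_gt0 (R : realType) N (a : 'I_N -> R) : \sum_i a i = 1 -> (0 < N)%N.
Proof.
by case: N a => // a; rewrite big_ord0 => /esym/eqP; rewrite oner_eq0.
Qed.

Section lower_bound.
Context {R : realType} {d : nat}.
Local Notation V := 'rV[R]_d.

(** The exponential of the potential of the overview: without the logarithm it is linear in the
    Gaussians, and it enters the Donsker-Varadhan integral in this form. *)
Definition soft_potential N (e : R) (x : 'I_N -> V) (alpha : 'I_N -> R) (v : V) : R :=
  \sum_i expR (alpha i) * gaussian e (x i) v.

Section soft_potential.
Context {N : nat} (e : R) (x : 'I_N -> V) (alpha : 'I_N -> R).
Hypothesis e0 : 0 < e.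
Local Notation S := (soft_potential e x alpha).

Lemma soft_potential_ge0 v : 0 <= S v.
Proof.
by apply: sumr_ge0 => i _; rewrite mulr_ge0 ?expR_ge0// ltW// gaussian_gt0.
Qed.

Lemma soft_potential_gt0 v : (0 < N)%N -> 0 < S v.
Proof.
case: N x alpha => // N' x' alpha' _.
rewrite /soft_potential big_ord_recl ltr_pwDl ?mulr_gt0 ?expR_gt0//.
by apply: sumr_ge0 => i _; rewrite mulr_ge0 ?expR_ge0// ltW// gaussian_gt0.
Qed.

Lemma soft_potential_le v : S v <= \sum_i expR (alpha i).
Proof.
by apply: ler_sum => i _; rewrite ler_piMr ?expR_ge0// gaussian_le1.
Qed.

Lemma measurable_soft_potential : measurable_fun setT S.
Proof.
apply: measurable_sum => i; apply: measurable_funM => //.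
exact: measurable_gaussian.
Qed.

Variable delta : R.
Hypothesis delta0 : 0 < delta.

Lemma ln_soft_potential_bounded v :
  `|ln (delta + S v)| <= `|ln delta| + `|ln (delta + \sum_i expR (alpha i))|.
Proof.
have Sd : 0 < delta + S v by rewrite ltr_wpDr// soft_potential_ge0.
have le1 : ln delta <= ln (delta + S v).
  by rewrite ler_ln ?posrE// lerDl soft_potential_ge0.
have le2 : ln (delta + S v) <= ln (delta + \sum_i expR (alpha i)).
  have h : delta + S v <= delta + \sum_i expR (alpha i).
    by rewrite lerD2l soft_potential_le.
  by rewrite ler_ln ?posrE// (lt_le_trans Sd).
rewrite ler_norml; apply/andP; split.
  apply: le_trans le1; rewrite opprD.
  have := ler_norm (- ln delta); rewrite normrN.
  have := normr_ge0 (ln (delta + \sum_i expR (alpha i))); lra.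
apply: (le_trans le2); have := ler_norm (ln (delta + \sum_i expR (alpha i))).
have := normr_ge0 (ln delta); lra.
Qed.

Lemma measurable_ln_soft_potential :
  measurable_fun setT (fun v => ln (delta + S v)).
Proof.
apply: (measurableT_comp (@measurable_ln R)).
by apply: measurable_funD => //; exact: measurable_soft_potential.
Qed.

(** A sum of positive terms dominates its [i]-th term [exp (alpha i)] times the kernel at [x i];
    taking logarithms gives the dual constraint, and [delta] only helps. *)
Lemma ln_soft_potential_dual i v :
  alpha i - ln (delta + S v) <= e^-1 * (2^-1 * sqdist (x i) v).
Proof.
rewrite lerBlDr -lerBlDl.
have h : expR (alpha i - e^-1 * (2^-1 * sqdist (x i) v)) <= delta + S v.
  rewrite expRD -[X in _ * X]/(gaussian e (x i) v).
  rewrite /soft_potential (bigD1 i)//= addrCA lerDl addr_ge0 ?(ltW delta0)//.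
  apply: sumr_ge0 => j _; rewrite mulr_ge0 ?expR_ge0// ltW// gaussian_gt0//.
rewrite -[leLHS]expRK ler_ln// posrE ?expR_gt0//.
by rewrite ltr_wpDr// soft_potential_ge0.
Qed.

End soft_potential.

Context {n m : nat}.
Variables (a : 'I_n -> R) (x : 'I_n -> V) (b : 'I_m -> R) (y : 'I_m -> V).
Hypotheses (a_ge0 : forall i, 0 <= a i) (b_ge0 : forall j, 0 <= b j).
Hypotheses (sum_a : \sum_i a i = 1) (sum_b : \sum_j b j = 1).
Hypotheses (x_inj : injective x) (y_inj : injective y).
Variables (gamma P : probability (V * V)%type R) (e : R).
Hypothesis e0 : 0 < e.
Variables (alpha : 'I_n -> R) (beta : 'I_m -> R) (f : V * V -> R) (K : R).
Hypotheses (mf : measurable_fun setT f) (fK : forall z, `|f z| <= K).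

Local Notation Ca := (\sum_i expR (alpha i)).
Local Notation Cb := (\sum_j expR (beta j)).

(* Adding [delta] keeps the potentials bounded below; it is removed by letting it tend
   to [0] in [entropic_cost_ge]. *)
Lemma entropic_cost_ge_delta (delta : R) : 0 < delta ->
  ((\sum_i a i * alpha i + \sum_j b j * beta j + \int[P]_z f z
    - ln (\int[gamma]_z expR (f z + ln (delta + soft_potential e x alpha z.1)
            + ln (delta + soft_potential e y beta z.2))))%:E <=
   entropic_cost (discrete_measure a x) (discrete_measure b y) gamma e P)%E.
Proof.
move=> d0; rewrite /entropic_cost.
set p1 := fun v => ln (delta + soft_potential e x alpha v).
set p2 := fun v => ln (delta + soft_potential e y beta v).
have mp1 : measurable_fun setT p1 by exact: measurable_ln_soft_potential.
have mp2 : measurable_fun setT p2 by exact: measurable_ln_soft_potential.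
have [K1 p1K] : exists K1, forall v, `|p1 v| <= K1.
  by eexists => v; exact: ln_soft_potential_bounded.
have [K2 p2K] : exists K2, forall v, `|p2 v| <= K2.
  by eexists => v; exact: ln_soft_potential_bounded.
have T1 := transport_cost_ge (distribution P fst) a_ge0 sum_a x_inj e0 mp1 p1K
  (ln_soft_potential_dual e x alpha d0).
have T2 := transport_cost_ge (distribution P snd) b_ge0 sum_b y_inj e0 mp2 p2K
  (ln_soft_potential_dual e y beta d0).
pose phi z := f z + p1 z.1 + p2 z.2.
have mp1' : measurable_fun setT (fun z : V * V => p1 z.1).
  exact: measurableT_comp mp1 measurable_fst.
have mp2' : measurable_fun setT (fun z : V * V => p2 z.2).
  exact: measurableT_comp mp2 measurable_snd.
have mfp : measurable_fun setT (fun z => f z + p1 z.1) by exact: measurable_funD.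
have fpK z : `|f z + p1 z.1| <= K + K1 by rewrite (le_trans (ler_normD _ _))// lerD.
have mphi : measurable_fun setT phi by exact: measurable_funD.
have phiK z : `|phi z| <= K + K1 + K2.
  by rewrite (le_trans (ler_normD _ _))// lerD.
have H := donsker_varadhan P gamma mphi phiK.
have I1 : \int[distribution P fst]_v p1 v = \int[P]_z p1 z.1.
  congr fine; rewrite integral_distribution//; first exact/measurable_EFinP.
  exact: (@bounded_integrable _ _ _ _ _ K1).
have I2 : \int[distribution P snd]_v p2 v = \int[P]_z p2 z.2.
  congr fine; rewrite integral_distribution//; first exact/measurable_EFinP.
  exact: (@bounded_integrable _ _ _ _ _ K2).
have I3 : \int[P]_z phi z = \int[P]_z f z + \int[P]_z p1 z.1 + \int[P]_z p2 z.2.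
  rewrite /phi RintegralD//.
  - rewrite RintegralD//.
    + exact: bounded_integrable fK.
    + exact: (@bounded_integrable _ _ _ _ _ K1).
  - exact: bounded_integrable fpK.
  - exact: (@bounded_integrable _ _ _ _ _ K2).
apply: le_trans (leeD (leeD T1 T2) H); rewrite -!EFinD lee_fin I1 I2 I3.
rewrite -[X in ln X]/(\int[gamma]_z expR (phi z)); lra.
Qed.

(** Multiplying out the two sums leaves one Laplace integral for each pair of atoms. *)
Lemma Rintegral_soft_potential :
  \int[gamma]_z (expR (f z) * soft_potential e x alpha z.1
                 * soft_potential e y beta z.2) =
  \sum_i \sum_j expR (alpha i + beta j) *
    \int[gamma]_z (expR (f z) * gaussian2 e (x i, y j) z).
Proof.
have mef : measurable_fun setT (fun z => expR (f z)) by exact: measurableT_comp mf.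
have efK z : `|expR (f z)| <= expR K.
  rewrite ger0_norm ?expR_ge0// ler_expR.
  by rewrite (le_trans (ler_norm _)).
have mg i j : measurable_fun setT (fun z => expR (f z) * gaussian2 e (x i, y j) z).
  by apply: measurable_funM => //; exact: measurable_gaussian2.
have gK i j z : `|expR (f z) * gaussian2 e (x i, y j) z| <= expR K.
  rewrite normrM (ger0_norm (ltW (gaussian2_gt0 _ _ _))).
  by rewrite (le_trans _ (efK z))// ler_piMr// gaussian2_le1.
have cgi i j : gamma.-integrable setT (EFin \o (fun z =>
    expR (alpha i + beta j) * (expR (f z) * gaussian2 e (x i, y j) z))).
  apply: (@bounded_integrable _ _ _ _ _ (expR (alpha i + beta j) * expR K)).
    exact: measurable_funM.
  by move=> z; rewrite normrM (ger0_norm (expR_ge0 _)) ler_wpM2l ?expR_ge0.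
transitivity (\int[gamma]_z (\sum_i \sum_j expR (alpha i + beta j) *
    (expR (f z) * gaussian2 e (x i, y j) z))).
  congr fine; apply: eq_integral => z _; congr EFin.
  rewrite -mulrA /soft_potential big_distrlr/= mulr_sumr.
  apply: eq_bigr => i _.
  rewrite mulr_sumr; apply: eq_bigr => j _.
  by rewrite expRD /gaussian2 /=; ring.
rewrite Rintegral_sum => [|i]; last first.
  rewrite (_ : _ \o _ = fun z => (\sum_j (expR (alpha i + beta j) *
      (expR (f z) * gaussian2 e (x i, y j) z))%:E)%E); last first.
    by apply/funext => z; rewrite /= sumEFin.
  by apply: integrable_sum => // j _; exact: cgi.
apply: eq_bigr => i _; rewrite Rintegral_sum//; apply: eq_bigr => j _.
rewrite RintegralZl//.
exact: bounded_integrable (gK i j).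
Qed.

Lemma entropic_cost_ge :
  ((\sum_i a i * alpha i + \sum_j b j * beta j + \int[P]_z f z
    - ln (\sum_i \sum_j expR (alpha i + beta j) *
            \int[gamma]_z (expR (f z) * gaussian2 e (x i, y j) z)))%:E <=
   entropic_cost (discrete_measure a x) (discrete_measure b y) gamma e P)%E.
Proof.
rewrite -Rintegral_soft_potential.
set Z := \int[gamma]_z _.
have mef : measurable_fun setT (fun z => expR (f z)) by exact: measurableT_comp mf.
have efK z : expR (f z) <= expR K by rewrite ler_expR (le_trans (ler_norm _)).
have mS1 : measurable_fun setT (fun z : V * V => soft_potential e x alpha z.1).
  exact: measurableT_comp (measurable_soft_potential _ _ _) measurable_fst.
have mS2 : measurable_fun setT (fun z : V * V => soft_potential e y beta z.2).
  exact: measurableT_comp (measurable_soft_potential _ _ _) measurable_snd.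
have S10 := soft_potential_ge0 e x alpha.
have S20 := soft_potential_ge0 e y beta.
have S1C := soft_potential_le x alpha e0.
have S2C := soft_potential_le y beta e0.
pose h z := expR (f z) * soft_potential e x alpha z.1 * soft_potential e y beta z.2.
have mh : measurable_fun setT h.
  by apply: measurable_funM => //; exact: measurable_funM.
have h0 z : 0 <= h z by rewrite !mulr_ge0 ?expR_ge0.
have hK z : `|h z| <= expR K * Ca * Cb.
  rewrite ger0_norm// ler_pM//; first by rewrite mulr_ge0 ?expR_ge0.
  by rewrite ler_pM ?expR_ge0.
have Z0 : 0 < Z.
  apply: Rintegral_gt0 hK => // z.
  by rewrite /h !mulr_gt0 ?expR_gt0// soft_potential_gt0// ?(sum1_gt0 sum_a)
    ?(sum1_gt0 sum_b).
apply/lee_addgt0Pr => eta eta0.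
(* For [delta <= 1], [C] bounds the coefficient of [delta] in the expansion of [hd]. The choice of
   [delta] below then raises the integral by at most [eta * Z], hence its logarithm by at most
   [ln (1 + eta) <= eta]. *)
pose C := expR K * (Ca + Cb + 1).
have Ca0 : 0 <= Ca by apply: sumr_ge0 => i _; exact: expR_ge0.
have Cb0 : 0 <= Cb by apply: sumr_ge0 => i _; exact: expR_ge0.
have C0 : 0 < C by rewrite mulr_gt0 ?expR_gt0// ltr_wpDl// addr_ge0.
pose delta := Num.min 1 (eta * Z / C).
have d0 : 0 < delta by rewrite lt_min ltr01 divr_gt0// mulr_gt0.
have d1 : delta <= 1 by rewrite ge_min lexx.
have dC : delta * C <= eta * Z.
  by rewrite -ler_pdivlMr// /delta ge_min lexx orbT.
pose hd z := expR (f z + ln (delta + soft_potential e x alpha z.1)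
  + ln (delta + soft_potential e y beta z.2)).
have Sd1 v : 0 < delta + soft_potential e x alpha v by rewrite ltr_wpDr.
have Sd2 v : 0 < delta + soft_potential e y beta v by rewrite ltr_wpDr.
have hdE z : hd z = expR (f z) * (delta + soft_potential e x alpha z.1)
    * (delta + soft_potential e y beta z.2).
  by rewrite /hd !expRD !lnK ?posrE.
have hdh z : hd z <= h z + delta * C.
  rewrite hdE /h /C.
  have -> : expR (f z) * (delta + soft_potential e x alpha z.1)
      * (delta + soft_potential e y beta z.2) =
    expR (f z) * soft_potential e x alpha z.1 * soft_potential e y beta z.2
    + delta * (expR (f z) * (soft_potential e x alpha z.1 +
                soft_potential e y beta z.2 + delta)) by ring.
  rewrite lerD2l ler_wpM2l ?(ltW d0)// ler_pM ?expR_ge0//.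
    by rewrite !addr_ge0// ltW.
  by rewrite !lerD.
have mhd : measurable_fun setT hd.
  rewrite (_ : hd = fun z => expR (f z) * (delta + soft_potential e x alpha z.1)
    * (delta + soft_potential e y beta z.2)); last by apply/funext => z.
  by apply: measurable_funM; first apply: measurable_funM => //;
    exact: measurable_funD.
have hdK z : `|hd z| <= expR K * Ca * Cb + delta * C.
  rewrite ger0_norm ?expR_ge0// (le_trans (hdh z))// lerD2r.
  by rewrite (le_trans _ (hK z))// ler_norm.
have := entropic_cost_ge_delta d0.
rewrite -[X in ln X]/(\int[gamma]_z hd z); set Zd := \int[gamma]_z hd z => LB.
have Zd0 : 0 < Zd by apply: Rintegral_gt0 hdK => // z; exact: expR_gt0.
have ZdZ : Zd <= Z * (1 + eta).
  apply: (@le_trans _ _ (Z + delta * C)); last by rewrite mulrDr mulr1 lerD2l (mulrC Z).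
  have hi := bounded_integrable gamma mh hK.
  have ci : gamma.-integrable setT (EFin \o (fun=> delta * C)).
    exact: (@bounded_integrable _ _ _ _ _ `|delta * C|).
  rewrite -[delta * C](Rintegral_prob_cst gamma) -RintegralD//.
  apply: le_Rintegral => //.
  - exact: bounded_integrable hdK.
  - apply: (@bounded_integrable _ _ _ _ _ (expR K * Ca * Cb + `|delta * C|)).
      exact: measurable_funD.
    by move=> z; rewrite (le_trans (ler_normD _ _))// lerD//; exact: hK.
have : ln Zd <= ln Z + eta.
  apply: (@le_trans _ _ (ln (Z * (1 + eta)))).
    by rewrite ler_ln ?posrE// mulr_gt0// ltr_wpDr// ltW.
  rewrite lnM ?posrE//; last by rewrite ltr_wpDr// ltW.
  by rewrite lerD2l le_ln1Dx// (lt_trans _ eta0)// ltrN10.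
move=> lnZd; apply: (le_trans _ (leeD2r eta%:E LB)).
by rewrite -EFinD lee_fin; lra.
Qed.

End lower_bound.

(** * The competitor *)

Section density_probability.
Local Open Scope ereal_scope.
Context d (T : measurableType d) (R : realType).
Variables (mu : {measure set T -> \bar R}) (f : T -> \bar R).

(* The hypotheses are arguments so that the instances below can be inferred. *)
Definition density_measure (mf : measurable_fun setT f) (f0 : forall z, 0 <= f z)
  (A : set T) : \bar R := \int[mu]_(z in A) f z.

Hypotheses (mf : measurable_fun setT f) (f0 : forall z, 0 <= f z).

Let density_measure0 : density_measure mf f0 set0 = 0.
Proof. exact: integral_set0. Qed.

Let density_measure_ge0 A : 0 <= density_measure mf f0 A.
Proof. exact: integral_ge0. Qed.

Let density_measure_sigma_additive : semi_sigma_additive (density_measure mf f0).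
Proof.
move=> /= A mA tA mUA; rewrite /density_measure/= ge0_integral_bigcup//=; last first.
  exact: measurable_funTS.
apply: is_cvg_ereal_nneg_natsum_cond => n _ _.
exact: integral_ge0.
Qed.

HB.instance Definition _ := isMeasure.Build _ _ _ (density_measure mf f0)
  density_measure0 density_measure_ge0 density_measure_sigma_additive.

Lemma ex_density_probability : \int[mu]_z f z = 1 ->
  exists P : probability T R,
    forall A, measurable A -> P A = \int[mu]_(z in A) f z.
Proof.
move=> f1.
have P1 : density_measure mf f0 setT = 1 by [].
pose HP := Measure_isProbability.Build _ _ R (density_measure mf f0) P1.
pose P : probability T R := HB.pack (density_measure mf f0) HP.
by exists P.
Qed.

End density_probability.

(** * Mixtures of reweighted measures on disjoint sets *)

Section mixture.
Context d (T : measurableType d) (R : realType) (I : finType).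
Variables (gamma : probability T R) (D : I -> set T) (G : I -> T -> R) (p : I -> R).
Hypotheses (mD : forall i, measurable (D i))
  (D_inj : forall i j z, D i z -> D j z -> i = j).
Hypotheses (mG : forall i, measurable_fun setT (G i))
  (G_gt0 : forall i z, 0 < G i z) (G_le1 : forall i z, G i z <= 1).
Hypotheses (p_ge0 : forall i, 0 <= p i) (sum_p : \sum_i p i = 1).

Let Z i := \int[gamma]_z (\1_(D i) z * G i z).
Hypothesis Z_gt0 : forall i, 0 < Z i.

Let f z := \sum_i p i / Z i * (\1_(D i) z * G i z).

Let pZ_ge0 i : 0 <= p i / Z i. Proof. by rewrite divr_ge0// ltW. Qed.

Let f_on i z : D i z -> f z = p i / Z i * G i z.
Proof.
move=> Dz; rewrite /f (bigD1 i)//= big1 => [|j ji].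
  by rewrite indicE mem_set// mul1r addr0.
rewrite indicE memNset ?mul0r ?mulr0// => Djz.
by move: ji; rewrite (D_inj Djz Dz) eqxx.
Qed.

Let f_off z : (forall i, ~ D i z) -> f z = 0.
Proof.
by move=> Dz; rewrite /f big1// => i _; rewrite indicE memNset// mul0r mulr0.
Qed.

Let indic_bound (A : set T) z : `|\1_A z| <= 1 :> R.
Proof. by rewrite indicE; case: (_ \in _); rewrite ?normr1 ?normr0. Qed.

Let DG_ge0 i z : 0 <= \1_(D i) z * G i z.
Proof. by rewrite mulr_ge0// ltW. Qed.

Let DG_le1 i z : `|\1_(D i) z * G i z| <= 1.
Proof.
by rewrite normrM mulr_ile1// (ger0_norm (ltW (G_gt0 _ _))).
Qed.

Let mDG i : measurable_fun setT (fun z => \1_(D i) z * G i z).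
Proof. by apply: measurable_funM => //; exact: measurable_indic. Qed.

Let f_ge0 z : 0 <= f z.
Proof. by apply: sumr_ge0 => i _; rewrite mulr_ge0. Qed.

Let mf : measurable_fun setT f.
Proof. by apply: measurable_sum => i; exact: measurable_funM. Qed.

(** Off the sets [D i] the density [f] vanishes, so only the constant values of [phi] on them
    matter; [Z i] cancels against the integral it normalizes. *)
Let mixture_Rintegral (phi : T -> R) (c : I -> R) :
  (forall i z, D i z -> phi z = c i) ->
  (\int[gamma]_z (phi z * f z)%:E = (\sum_i c i * p i)%:E)%E.
Proof.
move=> phic.
have E z : phi z * f z = \sum_i (c i * (p i / Z i)) * (\1_(D i) z * G i z).
  have [[i Di]|ND] := pselect (exists i, D i z).
    rewrite (f_on Di) (phic _ _ Di) (bigD1 i)//= big1 => [|j ji].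
      by rewrite indicE mem_set// mul1r addr0 mulrA.
    rewrite indicE memNset ?mul0r ?mulr0// => Djz.
    by move: ji; rewrite (D_inj Djz Di) eqxx.
  rewrite f_off ?mulr0 => [|i Di]; last by apply: ND; exists i.
  rewrite big1// => i _; rewrite indicE memNset ?mul0r ?mulr0// => Di.
  by apply: ND; exists i.
have ci i : gamma.-integrable setT
    (EFin \o (fun z => (c i * (p i / Z i)) * (\1_(D i) z * G i z))).
  apply: (@bounded_integrable _ _ _ _ _ `|c i * (p i / Z i)|).
    exact: measurable_funM.
  by move=> z; rewrite normrM ler_piMr.
under eq_integral do rewrite E.
rewrite -[LHS]fineK; last first.
  apply: integrable_fin_num => //.
  under eq_fun do rewrite -sumEFin.
  by apply: integrable_sum => // i _; exact: ci.
congr EFin; rewrite -[LHS]/(\int[gamma]_z _) Rintegral_sum//.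
apply: eq_bigr => i _; rewrite RintegralZl//; last exact: bounded_integrable (@DG_le1 i).
by rewrite -mulrA divfK// gt_eqF.
Qed.

(** On [D i] the log-density is [ln (p i / Z i)] plus [ln (G i) = - C], so the entropy splits into a
    finite sum and minus the integral of [C]. An event that contains or avoids each [D i] entirely,
    as recorded by the booleans [c], has the probability given by the weights. *)
Lemma ex_mixture : exists P : probability T R,
  (forall (E : set T) (c : I -> bool), measurable E ->
    (forall i z, D i z -> E z <-> c i) -> P E = (\sum_i p i * (c i)%:R)%:E) /\
  (forall (C : T -> R) (K : R), measurable_fun setT C -> (forall z, `|C z| <= K) ->
    (forall i z, D i z -> ln (G i z) = - C z) ->
    relative_entropy P gamma =
      (\sum_i p i * ln (p i / Z i) - \int[P]_z C z)%:E).
Proof.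
have mf' : measurable_fun setT (EFin \o f) by exact/measurable_EFinP.
have f0' z : (0 <= (EFin \o f) z)%E by rewrite lee_fin.
have f1 : (\int[gamma]_z (EFin \o f) z = 1)%E.
  have := @mixture_Rintegral (cst 1) (cst 1) (fun _ _ _ => erefl).
  under [X in _ = X%:E]eq_bigr do rewrite mul1r.
  by rewrite sum_p => <-; apply: eq_integral => z _; rewrite mul1r.
have [P PE] := ex_density_probability mf' f0' f1.
have PEc (E : set T) (c : I -> bool) : measurable E ->
    (forall i z, D i z -> E z <-> c i) -> P E = (\sum_i p i * (c i)%:R)%:E.
  move=> mE Ec; rewrite PE// integral_mkcond epatch_indic.
  transitivity (\int[gamma]_z (\1_E z * f z)%:E)%E.
    by apply: eq_integral => z _; rewrite /= -EFinM mulrC.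
  rewrite (@mixture_Rintegral _ (fun i => (c i)%:R)).
    by congr EFin; apply: eq_bigr => i _; rewrite mulrC.
  move=> i z Dz; rewrite indicE; have [Ecz cEz] := Ec i z Dz.
  case: (boolP (c i)) => ci; first by rewrite mem_set//; exact: cEz.
  by rewrite memNset// => /Ecz; exact/negP.
exists P; split => // C K mC CK GC.
rewrite (relative_entropyE _ PE); last exact/measurable_EFinP.
pose L z := \sum_i ln (p i / Z i) * \1_(D i) z.
have mLi i : measurable_fun setT (fun z => ln (p i / Z i) * \1_(D i) z).
  by apply: measurable_funM => //; exact: measurable_indic.
have mL : measurable_fun setT L by exact: measurable_sum.
have LKi i z : `|ln (p i / Z i) * \1_(D i) z| <= `|ln (p i / Z i)|.
  by rewrite normrM ler_piMr.
have LK z : `|L z| <= \sum_i `|ln (p i / Z i)|.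
  by rewrite (le_trans (ler_norm_sum _ _ _))// ler_sum.
have mf0 : measurable [set z | f z == 0].
  rewrite (_ : mkset _ = f @^-1` [set 0]).
    by rewrite -[X in measurable X]setTI; exact: mf.
  by apply/seteqP; split => z /= /eqP.
have Pf0 : P [set z | f z == 0] = 0%E.
  by rewrite PE//; apply: integral0_eq => z /= /eqP ->.
have mLC : measurable_fun setT (fun z => L z - C z) by exact: measurable_funB.
have LCK z : `|L z - C z| <= \sum_i `|ln (p i / Z i)| + K.
  by rewrite (le_trans (ler_normB _ _))// lerD.
transitivity (\int[P]_z (L z - C z)%:E)%E.
  apply: ae_eq_integral => //.
  - apply: (measurableT_comp (@measurable_lne R)); exact/measurable_EFinP.
  - exact/measurable_EFinP.
  exists [set z | f z == 0]; split => // z /= hz; apply: contrapT => /negP fz.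
  apply: hz => _; have fz0 : 0 < f z by rewrite lt_neqAle eq_sym fz f_ge0.
  rewrite leNgt fz0/=; congr EFin.
  have [[i Di]|ND] := pselect (exists i, D i z); last first.
    by move: fz; rewrite f_off ?eqxx// => i Di; apply: ND; exists i.
  move: fz0; rewrite (f_on Di) pmulr_lgt0// => pZ0.
  rewrite lnM ?posrE// (GC _ _ Di) /L (bigD1 i)//= big1 => [|j ji].
    by rewrite indicE mem_set// mulr1 addr0.
  rewrite indicE memNset ?mulr0// => Djz.
  by move: ji; rewrite (D_inj Djz Di) eqxx.
rewrite (EFin_Rintegral P mLC LCK) RintegralB//; last 2 first.
- exact: bounded_integrable LK.
- exact: bounded_integrable CK.
congr (_ - _)%:E; rewrite Rintegral_sum; last first.
  by move=> i; exact: bounded_integrable (@LKi i).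
apply: eq_bigr => i _; rewrite RintegralZl//; last first.
  exact: bounded_integrable (@indic_bound (D i)).
rewrite mulrC; congr (_ * _).
rewrite /Rintegral integral_indic// setIT [X in fine X](@PEc _ (pred1 i))//=.
  rewrite (bigD1 i)//= big1 => [|j /negbTE ->]; last by rewrite mulr0.
  by rewrite eqxx mulr1 addr0.
by move=> j z Djz; split => [Diz|/eqP <-//]; rewrite (D_inj Djz Diz).
Qed.

End mixture.

(** * Truncated Voronoi cells and the map to their centres *)

Section cells.
Context {R : realType} {d N : nat}.
Local Notation V := 'rV[R]_d.
Variable x : 'I_N -> V.
Hypothesis x_inj : injective x.

Lemma sqdist_eq0 n (u v : 'rV[R]_n) : (sqdist u v == 0) = (u == v).
Proof.
rewrite psumr_eq0 => [|i _]; last exact: sqr_ge0.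
apply/idP/eqP => [/allP uv|->]; last first.
  by apply/allP => i _ /=; rewrite subrr expr0n/=.
apply/rowP => i; apply/eqP; rewrite -subr_eq0 -sqrf_eq0.
by apply: uv; rewrite mem_index_enum.
Qed.

(* Points tied between two centres belong to no cell, so cells are disjoint. *)
Definition cell (i : 'I_N) : set V :=
  [set v | sqdist (x i) v <= 1 /\
           forall j, j != i -> sqdist (x i) v < sqdist (x j) v].

Lemma cell_inj i j v : cell i v -> cell j v -> i = j.
Proof.
move=> [_ iv] [_ jv]; apply/eqP; apply: contraT => ij.
by have := lt_trans (jv _ ij) (iv _ (_ : j != i)); rewrite ltxx eq_sym; exact.
Qed.

Lemma measurable_cell i : measurable (cell i).
Proof.
have ms j : measurable_fun setT (sqdist (x j)) by exact: measurable_sqdist.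
have mb (g : V -> bool) : measurable_fun setT g -> measurable [set v | g v].
  by move=> mg; rewrite -[X in measurable X]setTI; exact: (mg measurableT [set true]).
rewrite (_ : cell i = [set v | sqdist (x i) v <= 1] `&`
    \bigcap_(j in [set j | j != i]) [set v | sqdist (x i) v < sqdist (x j) v]).
  apply: measurableI; first by apply: mb; exact: measurable_fun_ler.
  apply: fin_bigcap_measurable => [|j _]; first exact: finite_finset.
  by apply: mb; exact: measurable_fun_ltr.
by apply/seteqP; split => v [].
Qed.

(** At the centre the finitely many defining inequalities hold with room to spare, so they persist
    nearby. The indicator of a cell is therefore continuous at its centre, as Laplace's method
    requires. *)
Lemma nbhs_cell i : nbhs (x i) (cell i).
Proof.
have xi0 : sqdist (x i) (x i) = 0 by apply/eqP; rewrite sqdist_eq0.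
have c j : sqdist (x j) v @[v --> x i] --> sqdist (x j) (x i).
  exact: continuous_sqdist.
have H1 : \forall v \near x i, sqdist (x i) v <= 1.
  by apply: (cvgr_le _ (c i)); rewrite xi0.
have H2 j : \forall v \near x i, j != i -> sqdist (x i) v < sqdist (x j) v.
  have [->|ji] := eqVneq j i; first by near=> v.
  have s0 : 0 < sqdist (x j) (x i).
    rewrite lt_neqAle sqdist_ge0 andbT eq_sym sqdist_eq0.
    by apply: contra ji => /eqP /x_inj ->.
  have h : sqdist (x j) (x i) / 2 < sqdist (x j) (x i).
    by rewrite ltr_pdivrMr// ltr_pMr// ltr1n.
  have h' : sqdist (x i) (x i) < sqdist (x j) (x i) / 2.
    by rewrite xi0 divr_gt0.
  near=> v => _; apply: (@lt_trans _ _ (sqdist (x j) (x i) / 2)).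
    by near: v; exact: (cvgr_lt _ (c i)).
  by near: v; exact: (cvgr_gt _ (c j)).
have {}H2 : \forall v \near x i, forall j, j != i -> sqdist (x i) v < sqdist (x j) v.
  exact: (@filter_forall _ _ _ (nbhs (x i)) _ H2).
by near=> v; split; near: v.
Unshelve. all: by end_near. Qed.

(* The identity off the cells, so that [|snap v - v|] is bounded everywhere. *)
Definition snap (v : V) : V := v + \sum_i (\1_(cell i) v : R) *: (x i - v).

Lemma snap_cell i v : cell i v -> snap v = x i.
Proof.
move=> iv; rewrite /snap (bigD1 i)//= big1 => [|j ji].
  by rewrite indicE mem_set// scale1r addr0 addrC subrK.
rewrite indicE memNset ?scale0r// => jv.
by move: ji; rewrite (cell_inj jv iv) eqxx.
Qed.

(** The radius 1 in [cell] serves here: the displacement cost is bounded, hence integrable under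
    every probability measure. *)
Lemma sqdist_snap v : 0 <= sqdist (snap v) v <= 1.
Proof.
rewrite sqdist_ge0/=; have [[i iv]|nv] := pselect (exists i, cell i v).
  by rewrite (snap_cell iv); case: iv.
rewrite /snap big1 => [|i _].
  by rewrite addr0 (_ : sqdist v v = 0)//; apply/eqP; rewrite sqdist_eq0.
by rewrite indicE memNset ?scale0r// => iv; apply: nv; exists i.
Qed.

Lemma measurable_snap : measurable_fun setT snap.
Proof.
apply: measurable_rV => k.
under eq_fun do rewrite /snap mxE summxE.
apply: measurable_funD; first exact: measurable_coord.
apply: measurable_sum => i; under eq_fun do rewrite !mxE.
apply: measurable_funM; first by apply: measurable_indic; exact: measurable_cell.
by apply: measurable_funB => //; exact: measurable_coord.
Qed.

End cells.

Section upper_bound.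
Context {R : realType} {d n m : nat}.
Local Notation V := 'rV[R]_d.
Variables (a : 'I_n -> R) (x : 'I_n -> V) (b : 'I_m -> R) (y : 'I_m -> V).
Hypotheses (x_inj : injective x) (y_inj : injective y).
Variables (gamma : probability (V * V)%type R) (e : R) (p : 'I_n * 'I_m -> R).
Hypotheses (e0 : 0 < e) (p_ge0 : forall k, 0 <= p k).
Hypotheses (p_a : forall i, \sum_j p (i, j) = a i)
  (p_b : forall j, \sum_i p (i, j) = b j) (sum_a : \sum_i a i = 1).

Definition cell_mass (k : 'I_n * 'I_m) : R :=
  \int[gamma]_z (\1_(cell x k.1 `*` cell y k.2) z * gaussian2 e (x k.1, y k.2) z).

(** On a product of cells, minus the logarithm of the kernel is the snapping cost divided by [e].
    The entropy of the mixture therefore contains minus the integral of that cost, which cancels the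
    bounds on the two transport terms. *)
Lemma entropic_cost_le : (forall k, 0 < cell_mass k) ->
  exists P, (entropic_cost (discrete_measure a x) (discrete_measure b y) gamma e P
    <= (\sum_k p k * ln (p k / cell_mass k))%:E)%E.
Proof.
move=> Z0.
have a_ge0 i : 0 <= a i by rewrite -p_a; apply: sumr_ge0.
have b_ge0 j : 0 <= b j by rewrite -p_b; apply: sumr_ge0.
have sum_p : \sum_k p k = 1.
  rewrite -sum_a; under [RHS]eq_bigr do rewrite -p_a.
  by rewrite pair_bigA; apply: eq_bigr => -[].
pose D (k : 'I_n * 'I_m) := cell x k.1 `*` cell y k.2.
have mD k : measurable (D k) by apply: measurableX; exact: measurable_cell.
have D_inj k l z : D k z -> D l z -> k = l.
  case: k l => [i j] [i' j'] [/= xi yj] [/= xi' yj'].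
  by rewrite (cell_inj xi xi') (cell_inj yj yj').
have [P [P1 P2]] := @ex_mixture _ _ _ _ gamma D
  (fun k => gaussian2 e (x k.1, y k.2)) p mD D_inj
  (fun k => measurable_gaussian2 e _) (fun k => gaussian2_gt0 e _)
  (fun k z => gaussian2_le1 _ z e0) p_ge0 sum_p Z0.
exists P.
have mS1 : measurable_fun setT (fun z : V * V => snap x z.1).
  exact: (measurableT_comp (@measurable_snap _ _ _ x) measurable_fst).
have mS2 : measurable_fun setT (fun z : V * V => snap y z.2).
  exact: (measurableT_comp (@measurable_snap _ _ _ y) measurable_snd).
pose S1 : {mfun (V * V)%type >-> V} := mfun_Sub (mem_set mS1).
pose S2 : {mfun (V * V)%type >-> V} := mfun_Sub (mem_set mS2).
(* [P] charges only the products of cells, where [snap] returns the centre, so the snapped law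
   carries the row sums of [p] at the atoms. *)
have S1mu : distribution P S1 ≡μ discrete_measure a x.
  move=> A mA; rewrite [RHS]discrete_measureE//.
  rewrite [LHS](P1 _ (fun k => x k.1 \in A)); last 2 first.
  - by rewrite -[X in measurable X]setTI; exact (mS1 measurableT _ mA).
  - move=> k z [/= xk yk]; rewrite /preimage/= (snap_cell xk).
    by split => [/mem_set|/set_mem].
  rewrite sumEFin; congr EFin.
  under [RHS]eq_bigr do rewrite -p_a mulr_suml.
  by rewrite pair_bigA; apply: eq_bigr => -[i j] _; rewrite indicE.
have S2nu : distribution P S2 ≡μ discrete_measure b y.
  move=> A mA; rewrite [RHS]discrete_measureE//.
  rewrite [LHS](P1 _ (fun k => y k.2 \in A)); last 2 first.
  - by rewrite -[X in measurable X]setTI; exact (mS2 measurableT _ mA).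
  - move=> k z [/= xk yk]; rewrite /preimage/= (snap_cell yk).
    by split => [/mem_set|/set_mem].
  rewrite sumEFin; congr EFin.
  under [RHS]eq_bigr do rewrite -p_b mulr_suml.
  by rewrite exchange_big pair_bigA; apply: eq_bigr => -[i j] _; rewrite indicE.
pose c1 (z : V * V) := 2^-1 * sqdist (snap x z.1) z.1.
pose c2 (z : V * V) := 2^-1 * sqdist (snap y z.2) z.2.
have mc1 : measurable_fun setT c1.
  by apply: measurable_funM => //; exact: measurable_sqdist.
have mc2 : measurable_fun setT c2.
  by apply: measurable_funM => //; exact: measurable_sqdist.
have half1 (t : R) : 0 <= t <= 1 -> `|2^-1 * t| <= 1.
  by move=> /andP[t0 t1]; rewrite ger0_norm ?mulr_ge0// mulr_ile1// invf_le1// ler1n.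
have c1K z : `|c1 z| <= 1 by apply: half1; exact: sqdist_snap.
have c2K z : `|c2 z| <= 1 by apply: half1; exact: sqdist_snap.
have T1 := transport_cost_le fst S1mu.
have T2 := transport_cost_le snd S2nu.
rewrite [leRHS](EFin_Rintegral P mc1 c1K) in T1.
rewrite [leRHS](EFin_Rintegral P mc2 c2K) in T2.
have ei0 : 0 <= e^-1 by rewrite invr_ge0 ltW.
pose C z := e^-1 * c1 z + e^-1 * c2 z.
have mec1 : measurable_fun setT (fun z => e^-1 * c1 z) by exact: measurable_funM.
have mec2 : measurable_fun setT (fun z => e^-1 * c2 z) by exact: measurable_funM.
have ec1K z : `|e^-1 * c1 z| <= e^-1 by rewrite normrM (ger0_norm ei0) ler_piMr.
have ec2K z : `|e^-1 * c2 z| <= e^-1 by rewrite normrM (ger0_norm ei0) ler_piMr.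
have mC : measurable_fun setT C by exact: measurable_funD.
have CK z : `|C z| <= e^-1 + e^-1 by rewrite (le_trans (ler_normD _ _))// lerD.
have H : relative_entropy P gamma =
    (\sum_k p k * ln (p k / cell_mass k) - \int[P]_z C z)%:E.
  apply: (P2 C _ mC CK) => k z [/= xk yk].
  rewrite gaussian2E expRK /C /c1 /c2 (snap_cell xk) (snap_cell yk) /sqdist2/=.
  by rewrite !mulrDr.
have IC : \int[P]_z C z = e^-1 * \int[P]_z c1 z + e^-1 * \int[P]_z c2 z.
  rewrite /C RintegralD//; last 2 first.
  - exact: bounded_integrable ec1K.
  - exact: bounded_integrable ec2K.
  rewrite RintegralZl//; last exact: bounded_integrable c1K.
  by rewrite [X in _ + X]RintegralZl//; exact: bounded_integrable c2K.
rewrite /entropic_cost H IC.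
have T1' := lee_wpmul2l (_ : (0 <= e^-1%:E)%E) T1.
have T2' := lee_wpmul2l (_ : (0 <= e^-1%:E)%E) T2.
apply: le_trans (leeD (leeD (T1' _) (T2' _)) (lexx _)) _; rewrite ?lee_fin//.
by rewrite addrC subrK.
Qed.

End upper_bound.

(** * The discrete Schroedinger problem *)

Section scaling.
Context {R : realType}.

Lemma ln_ge1V (t : R) : 0 < t -> 1 - t^-1 <= ln t.
Proof.
move=> t0; have ti : 0 < t^-1 by rewrite invr_gt0.
have : ln (1 + (t^-1 - 1)) <= t^-1 - 1 by rewrite le_ln1Dx//; lra.
by rewrite addrC subrK lnV ?posrE//; lra.
Qed.

(** Both sides vanish at [t = 0], so the line is tangent there to a curve of slope [a]: small
    negative [t] gives [A <= a], small positive [t] gives [a <= A]. *)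
Lemma slope_unique (a A : R) : 0 <= A ->
  (forall t, - 1 < t -> a * ln (1 + t) <= A * t) -> 0 < a -> A = a.
Proof.
move=> A0 H a0.
have H' t : - 1 < t -> a * (t / (1 + t)) <= A * t.
  move=> t1; have t10 : 0 < 1 + t by lra.
  apply: le_trans (H _ t1); rewrite ler_pM2l//.
  apply: le_trans (ln_ge1V t10).
  by rewrite -subr_ge0 (_ : _ - _ = 0)//; field; rewrite gt_eqF.
apply/eqP; rewrite eq_le; apply/andP; split; apply/ler_addgt0Pr => e e0.
  (* The cap [2^-1] keeps [t] above [- 1], and [e / (A + 1)] makes [A * - t] at most [e] even when
     [A] is 0. *)
  pose t := - Num.min (2^-1) (e / (A + 1)).
  have m0 : 0 < e / (A + 1) by rewrite divr_gt0// ltr_wpDl.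
  have t0 : t < 0 by rewrite oppr_lt0 lt_min m0 andbT invr_gt0.
  have t1 : - 1 < t.
    rewrite ltrN2 gt_min; apply/orP; left.
    by rewrite invf_lt1// ltr1n.
  have t10 : 0 < 1 + t by lra.
  have := H' _ t1; rewrite mulrA ler_pdivrMr// (mulrC A) -mulrA (mulrC a).
  rewrite ler_nM2l// => h; have : A * - t <= e.
    rewrite opprK; apply: (@le_trans _ _ (A * (e / (A + 1)))).
      by rewrite ler_wpM2l// ge_min lexx orbT.
    rewrite mulrA ler_pdivrMr ?ltr_wpDl// mulrC ler_wpM2l ?(ltW e0)//.
    by rewrite lerDl.
  by lra.
pose t := e / (A + 1).
have t0 : 0 < t by rewrite divr_gt0// ltr_wpDl.
have t10 : 0 < 1 + t by rewrite addr_gt0.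
have := H' t; rewrite mulrA ler_pdivrMr// (mulrC A) -mulrA (mulrC a) ler_pM2l//.
move=> /(_ _) h; have {}h := h (lt_trans (ltrN10 _) t0).
have : A * t <= e.
  rewrite mulrA ler_pdivrMr ?ltr_wpDl// mulrC ler_wpM2l ?(ltW e0)//.
  by rewrite lerDl.
by lra.
Qed.

Context {n m : nat}.
Variables (a : 'I_n -> R) (b : 'I_m -> R) (s : 'I_n -> 'I_m -> R).
Hypotheses (a_gt0 : forall i, 0 < a i) (b_gt0 : forall j, 0 < b j).
Hypotheses (sum_a : \sum_i a i = 1) (sum_b : \sum_j b j = 1).
Hypothesis s_gt0 : forall i j, 0 < s i j.

Let W j (al : 'rV[R]_n) := \sum_i expR (al ord0 i) * s i j.

Let W_ge j (al : 'rV[R]_n) i : expR (al ord0 i) * s i j <= W j al.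
Proof.
rewrite /W (bigD1 i)//= lerDl; apply: sumr_ge0 => k _.
by rewrite mulr_ge0 ?expR_ge0// ltW.
Qed.

Let W_gt0 j al : 0 < W j al.
Proof.
apply: lt_le_trans (W_ge j al (Ordinal (sum1_gt0 sum_a))).
by rewrite mulr_gt0 ?expR_gt0.
Qed.

(* The dual functional of the discrete problem, after maximization over the
   second potential. *)
Let G al := \sum_j b j * ln (W j al) - \sum_i a i * al ord0 i.

Let continuous_G : continuous G.
Proof.
have cW j : continuous (W j).
  apply: continuous_big => [|i _ v]; first exact: add_continuous.
  have c : (fun w : 'rV[R]_n => expR (w ord0 i)) @ v --> expR (v ord0 i).
    apply: (@cvg_comp _ _ _ _ expR _ (nbhs (v ord0 i))); last exact: continuous_expR.
    exact: coord_continuous.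
  exact: (cvgM c (cvg_cst _)).
move=> v.
have c1 : \sum_j b j * ln (W j w) @[w --> v] --> \sum_j b j * ln (W j v).
  apply: (@continuous_big _ _ +%R 0 xpredT add_continuous _ _ (fun j w => b j * ln (W j w))).
  move=> j _ w.
  have c : ln (W j u) @[u --> w] --> ln (W j w).
    apply: (@cvg_comp _ _ _ _ (@ln R) _ (nbhs (W j w))); first exact: cW.
    exact: continuous_ln.
  exact: (cvgM (cvg_cst _) c).
have c2 : \sum_i a i * w ord0 i @[w --> v] --> \sum_i a i * v ord0 i.
  apply: (@continuous_big _ _ +%R 0 xpredT add_continuous _ _
    (fun i (w : 'rV[R]_n) => a i * w ord0 i)).
  move=> i _ w.
  exact: (cvgM (cvg_cst _) (@coord_continuous _ _ _ ord0 i w)).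
exact: (cvgB c1 c2).
Qed.

Let G_shift (al : 'rV[R]_n) c : G (al + const_mx c) = G al.
Proof.
have WE j : W j (al + const_mx c) = expR c * W j al.
  rewrite /W mulr_sumr; apply: eq_bigr => i _; rewrite !mxE expRD; ring.
rewrite /G; under eq_bigr do rewrite WE (lnM _ (W_gt0 _ _)) ?posrE ?expR_gt0// expRK mulrDr.
under [X in _ - X]eq_bigr do rewrite !mxE mulrDr.
by rewrite !big_split/= -!mulr_suml sum_a sum_b; ring.
Qed.

Let ex_minimum : exists al, forall al', G al <= G al'.
Proof.
(* With largest coordinate 0, every [ln (W j v)] is at least [- l]. A coordinate below [- L], hence
   below [- T / a i], brings the linear term below [- T], so [G v >= T - l >= G 0]. *)
pose l : R := \sum_i \sum_j `|ln (s i j)|.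
have lP i j : - l <= ln (s i j).
  rewrite lerNl; apply: (le_trans (ler_norm _)); rewrite normrN.
  rewrite /l (bigD1 i)//= (bigD1 j)//= -addrA lerDl addr_ge0//.
    exact: sumr_ge0.
  by apply: sumr_ge0 => k _; exact: sumr_ge0.
pose T : R := `|G 0 + l|.
have Ta i : 0 <= T / a i by rewrite divr_ge0 ?normr_ge0 ?(ltW (a_gt0 i)).
pose L : R := \sum_i T / a i.
have L0 : 0 <= L by apply: sumr_ge0 => i _.
pose A := [set v : 'rV[R]_n | forall i, `[- L, 0]%classic (v ord0 i)].
have A0 : A 0 by move=> i /=; rewrite mxE in_itv/= lexx oppr_le0 L0.
have cA : compact A.
  exact: (@rV_compact R n (fun=> `[- L, 0]%classic) (fun i => @segment_compact R _ _)).
have An : A !=set0 by exists 0.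
have [c _ cmin] := EVT_min_rV An cA (continuous_subspaceT continuous_G).
exists c => al.
(* [G] is invariant under constant shifts, so we may normalize [max al = 0]; then [G]
   exceeds [G 0] as soon as one coordinate is below [- L]. *)
pose i0 := [arg max_(i > Ordinal (sum1_gt0 sum_a)) al ord0 i]%O.
have i0P i : al ord0 i <= al ord0 i0.
  by rewrite /i0; case: arg_maxP => //= j _; exact.
rewrite -(G_shift al (- al ord0 i0)).
set v := al + _.
have v0 i : v ord0 i <= 0 by rewrite /v !mxE subr_le0.
have vi0 : v ord0 i0 = 0 by rewrite /v !mxE subrr.
have [vA|vNA] := pselect (A v); first by apply: cmin; rewrite inE.
have [i1 i1L] : exists i1, v ord0 i1 < - L.
  apply: contrapT => vL; apply: vNA => i /=; rewrite in_itv/= v0 andbT leNgt.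
  by apply/negP => vi; apply: vL; exists i.
apply: (@le_trans _ _ (G 0)); first by apply: cmin; rewrite inE.
have h1 : - l <= \sum_j b j * ln (W j v).
  rewrite -[leLHS]mul1r -sum_b mulr_suml; apply: ler_sum => j _.
  rewrite ler_pM2l//; apply: (le_trans (lP i0 j)).
  by rewrite ler_ln ?posrE//; have := W_ge j v i0; rewrite vi0 expR0 mul1r.
have h2 : \sum_i a i * v ord0 i <= - T.
  rewrite (bigD1 i1)//= -[leRHS]addr0; apply: lerD; last first.
    by apply: sumr_le0 => i _; rewrite mulr_ge0_le0// ltW.
  apply: (@le_trans _ _ (a i1 * - L)); first by rewrite ler_pM2l// ltW.
  rewrite mulrN lerN2 /L (bigD1 i1)//= mulrDr mulrCA mulfV ?gt_eqF// mulr1.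
  rewrite lerDl mulr_ge0 ?(ltW (a_gt0 _))//; exact: sumr_ge0.
rewrite /G in h1 h2 *; have := ler_norm (G 0 + l); rewrite -/T /G; lra.
Qed.

(** This is the Schroedinger system. Given [alpha], the column equations determine [beta]
    explicitly; the row equations are then the stationarity of [G] at its minimum. *)
Lemma ex_scaling : exists (alpha : 'I_n -> R) (beta : 'I_m -> R),
  (forall i, \sum_j expR (alpha i + beta j) * s i j = a i) /\
  (forall j, \sum_i expR (alpha i + beta j) * s i j = b j).
Proof.
have [al alP] := ex_minimum.
(* The kernel normalized in each column: [b j * q i j] is the coupling sought. *)
pose q i j := expR (al ord0 i) * s i j / W j al.
have q_ge0 i j : 0 <= q i j.
  by rewrite divr_ge0 ?(ltW (W_gt0 _ _))// mulr_ge0 ?expR_ge0 ?(ltW (s_gt0 _ _)).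
have q_le1 i j : q i j <= 1 by rewrite ler_pdivrMr// mul1r.
exists (fun i => al ord0 i), (fun j => ln (b j / W j al)).
have E i j : expR (al ord0 i + ln (b j / W j al)) * s i j = b j * q i j.
  by rewrite expRD lnK ?posrE ?divr_gt0// /q; ring.
split=> [k|j]; under eq_bigr do rewrite E; last first.
  rewrite -mulr_sumr /q -mulr_suml -[X in X / _]/(W j al).
  by rewrite mulfV ?mulr1// gt_eqF.
(* The minimality of [al] tested along [ln (1 + t)] in the [k]-th coordinate. *)
apply: slope_unique => // [|t t1].
  by apply: sumr_ge0 => j _; rewrite mulr_ge0// ltW.
have t10 : 0 < 1 + t by lra.
pose al' := al + ln (1 + t) *: delta_mx ord0 k.
have al'k : al' ord0 k = al ord0 k + ln (1 + t) by rewrite !mxE !eqxx mulr1.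
have al'N i : i != k -> al' ord0 i = al ord0 i.
  by move=> ik; rewrite !mxE (negbTE ik) andbF mulr0 addr0.
(* Only the [k]-th term of [W j] is multiplied by [1 + t], and [q k j] is the share of that term in
   the sum. *)
have WE j : W j al' = W j al * (1 + t * q k j).
  have Wq : W j al * q k j = expR (al ord0 k) * s k j.
    by rewrite /q mulrC divfK// gt_eqF.
  rewrite mulrDr mulr1 mulrCA Wq.
  rewrite /W (bigD1 k)//= [in RHS](bigD1 k)//= al'k expRD lnK ?posrE//.
  under eq_bigr => i ik do rewrite al'N//.
  by ring.
have tq j : - 1 < t * q k j.
  have [t0|t0] := leP 0 t.
    by rewrite (lt_le_trans (ltrN10 _))// mulr_ge0.
  by rewrite (lt_le_trans t1)// ler_niMr// ltW.
have := alP al'; rewrite /G.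
under [X in _ <= X - _]eq_bigr => j _.
  rewrite WE lnM ?posrE//; last by have := tq j; lra.
  rewrite mulrDr; over.
rewrite big_split/= [X in _ <= _ - X](bigD1 k)//= al'k.
rewrite [X in _ - X <= _](bigD1 k)//=.
under [X in _ <= _ - (_ + X)]eq_bigr => i ik do rewrite al'N//.
rewrite mulrDr => h.
(* Bounding the logarithms by their tangent turns minimality into a linear bound in [t] whose slope
   is the [k]-th row sum. *)
have h2 : \sum_j b j * ln (1 + t * q k j) <= \sum_j b j * q k j * t.
  apply: ler_sum => j _; rewrite -mulrA ler_pM2l// (mulrC _ t).
  exact: le_ln1Dx.
rewrite mulr_suml; lra.
Qed.

End scaling.

(** * Gibbs' inequality and its equality case *)

Section gibbs.
Context {R : realType} (I : finType) (p w : I -> R).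
Hypotheses (p_ge0 : forall i, 0 <= p i) (w_gt0 : forall i, 0 < w i).
Hypothesis sum_pw : \sum_i p i = \sum_i w i.

(** This is [ln t >= 1 - t^-1] at [t = p i / w i]; the differences [p i - w i] sum to 0, so a
    termwise bound suffices for the sum. *)
Let gibbs_term i : p i - w i <= p i * ln (p i / w i).
Proof.
have := p_ge0 i; rewrite le0r => /orP[/eqP ->|pi0].
  by rewrite mul0r sub0r oppr_le0 ltW.
have := ln_ge1V (divr_gt0 pi0 (w_gt0 i)); rewrite invf_div.
rewrite -(ler_pM2l pi0) mulrBr mulr1 mulrCA mulfV ?gt_eqF// mulr1.
exact.
Qed.

Lemma gibbs_ge0 : 0 <= \sum_i p i * ln (p i / w i).
Proof.
apply: (@le_trans _ _ (\sum_i (p i - w i))); last exact: ler_sum.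
by rewrite sumrB sum_pw subrr.
Qed.

(** The gaps in the termwise inequality are nonnegative and sum to 0, so each is 0; strict convexity
    of exp then forces [p i = w i]. *)
Lemma gibbs_eq0 : \sum_i p i * ln (p i / w i) = 0 -> p = w.
Proof.
move=> S0.
have : \sum_i (p i * ln (p i / w i) - (p i - w i)) = 0.
  by rewrite !sumrB S0 sum_pw subrr subr0.
move/eqP; rewrite psumr_eq0 => [/allP H|i _]; last by rewrite subr_ge0.
apply/funext => i; have := H i (mem_index_enum _); rewrite /= subr_eq0 => /eqP.
have := p_ge0 i; rewrite le0r => /orP[/eqP ->|pi0].
  by rewrite mul0r => /esym/eqP; rewrite subr_eq0 eq_sym => /eqP.
have t0 := divr_gt0 pi0 (w_gt0 i).
have [/eqP|ln0] := eqVneq (ln (p i / w i)) 0.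
  rewrite ln_eq0// => /eqP h _.
  by rewrite -[LHS](@divfK _ (w i)) ?gt_eqF// h mul1r.
move=> E; have : - ln (p i / w i) != 0 by rewrite oppr_eq0.
move/expR_gt1Dx; rewrite expRN lnK ?posrE// invf_div -(ltr_pM2l pi0).
rewrite mulrDr mulr1 mulrN E (mulrCA (p i)) mulfV ?gt_eqF// mulr1; lra.
Qed.

End gibbs.

Lemma measure_eq_discreteE d (T : measurableType d) (R : realType) (I : finType)
    (w : I -> R) (p : I -> T) (P : {measure set T -> \bar R}) (A : set T) :
  P ≡μ discrete_measure w p -> (forall i, 0 <= w i) -> measurable A ->
  P A = (\sum_i (w i * \1_A (p i)))%:E.
Proof.
move=> PE w0 mA; rewrite (PE _ mA) [LHS](discrete_measureE p A w0).
by rewrite sumEFin.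
Qed.

(** * Integrals and entropy of finitely supported probabilities *)

Section discrete_entropy.
Context d (T : measurableType d) (R : realType) (I : finType).
Variables (q : I -> T) (p s : I -> R) (P : probability T R).
Hypotheses (q_inj : injective q) (mq : forall i, measurable [set q i]).
Hypotheses (p_ge0 : forall i, 0 <= p i) (s_gt0 : forall i, 0 < s i).
Hypothesis PE : P ≡μ discrete_measure p q.

Let P1 i : P [set q i] = (p i)%:E.
Proof. by rewrite PE// [LHS]discrete_measure1. Qed.

Let indic_q i j : \1_[set q i] (q j) = (j == i)%:R :> R.
Proof.
rewrite indicE; congr (nat_of_bool _)%:R.
by apply/idP/eqP => [/set_mem/q_inj //|->]; exact: mem_set.
Qed.

Let indic_bound (A : set T) z : `|\1_A z| <= 1 :> R.
Proof. by rewrite indicE; case: (_ \in _); rewrite ?normr1 ?normr0. Qed.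

Let mscaled (c : I -> R) i : measurable_fun setT (fun z => c i * \1_[set q i] z).
Proof. by apply: measurable_funM => //; exact: measurable_indic. Qed.

Let sumq (c : I -> R) j : \sum_i c i * \1_[set q i] (q j) = c j.
Proof.
rewrite (bigD1 j)//= big1 => [|i ij]; first by rewrite indic_q eqxx mulr1 addr0.
by rewrite indic_q eq_sym (negbTE ij) mulr0.
Qed.

(** Values are prescribed only at atoms of positive weight because the log-density is [-oo] at the
    others; these form part of a null set, which matches the convention [0 ln 0 = 0]. *)
Lemma integral_discrete (f : T -> \bar R) (g : I -> R) :
  measurable_fun setT f -> (forall i, 0 < p i -> f (q i) = (g i)%:E) ->
  (\int[P]_z f z = (\sum_i p i * g i)%:E)%E.
Proof.
move=> mf fg; pose L z := \sum_i g i * \1_[set q i] z.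
have mL : measurable_fun setT L by apply: measurable_sum => i; exact: mscaled.
have LKi i z : `|g i * \1_[set q i] z| <= `|g i| by rewrite normrM ler_piMr.
have LK z : `|L z| <= \sum_i `|g i|.
  by rewrite (le_trans (ler_norm_sum _ _ _))// ler_sum.
transitivity (\int[P]_z (L z)%:E)%E.
  apply: ae_eq_integral => //; first exact/measurable_EFinP.
  have mN : measurable (\bigcap_(i in [set i | 0 < p i]) ~` [set q i]).
    apply: fin_bigcap_measurable => [|i _]; first exact: finite_finset.
    exact: measurableC.
  exists (\bigcap_(i in [set i | 0 < p i]) ~` [set q i]); split => //.
    rewrite (measure_eq_discreteE PE)// big1// => i _.
    have := p_ge0 i; rewrite le0r => /orP[/eqP ->|pi0]; first by rewrite mul0r.
    by rewrite indicE memNset ?mulr0// => /(_ i pi0)/=; exact.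
  move=> z /= hz i /= pi0 zi; apply: hz => _.
  by rewrite zi fg// /L sumq.
rewrite (EFin_Rintegral P mL LK); congr EFin.
rewrite Rintegral_sum => [|i]; last first.
  by apply: (bounded_integrable _ _ (@LKi i)); exact: mscaled.
apply: eq_bigr => i _; rewrite RintegralZl//; last first.
  by apply: (bounded_integrable _ _ (@indic_bound [set q i])); exact: measurable_indic.
by rewrite mulrC /Rintegral integral_indic// setIT [X in fine X]P1.
Qed.

Lemma relative_entropy_discrete :
  relative_entropy P (discrete_measure s q) = (\sum_i p i * ln (p i / s i))%:E.
Proof.
pose h z := \sum_i p i / s i * \1_[set q i] z.
have ps_ge0 i : 0 <= p i / s i by rewrite divr_ge0// ltW.
have mh : measurable_fun setT h.
  by apply: measurable_sum => i; exact: (mscaled (fun i => p i / s i)).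
have hE A : measurable A -> P A = (\int[discrete_measure s q]_(z in A) (h z)%:E)%E.
  move=> mA; rewrite (measure_eq_discreteE PE)// -sumEFin.
  under eq_integral do rewrite -sumEFin.
  rewrite ge0_integral_sum//; last 2 first.
  - move=> i; apply: measurable_funTS; apply/measurable_EFinP.
    exact: (mscaled (fun i => p i / s i)).
  - by move=> i z _; rewrite lee_fin mulr_ge0// indicE; case: (_ \in _).
  apply: eq_bigr => i _; under eq_integral do rewrite EFinM.
  rewrite ge0_integralZl_EFin//; last first.
    by apply: measurable_funTS; apply/measurable_EFinP; exact: measurable_indic.
  rewrite integral_indic// [X in (_ * X)%E](discrete_measureE _ _ (fun i => ltW (s_gt0 i))).
  rewrite (bigD1 i)//= big1 => [|j ji].
    rewrite adde0 -EFinM; congr EFin.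
    rewrite mulrA divfK ?gt_eqF//; congr (_ * _).
    rewrite !indicE in_setI; congr (_%:R).
    by rewrite (mem_set (erefl : [set q i] (q i))).
  rewrite indicE in_setI memNset ?mulr0//= => /q_inj /eqP.
  by apply/negP.
rewrite (relative_entropyE _ hE); last exact/measurable_EFinP.
apply: integral_discrete => [|i pi0].
  apply: (measurableT_comp (@measurable_lne R)); exact/measurable_EFinP.
by rewrite /h (sumq (fun i => p i / s i)) lne_EFin// divr_gt0.
Qed.

End discrete_entropy.

Lemma ex_discrete_probability d (T : measurableType d) (R : realType) (I : finType)
    (p : I -> R) (q : I -> T) : (forall i, 0 <= p i) -> \sum_i p i = 1 ->
  exists P : probability T R, P ≡μ discrete_measure p q.
Proof.
move=> p0 p1; have P1 : discrete_measure p q setT = 1%E.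
  rewrite discrete_measureE// sumEFin -p1; congr EFin.
  by apply: eq_bigr => i _; rewrite indicE in_setT mulr1.
pose HP := Measure_isProbability.Build _ _ R (discrete_measure p q) P1.
pose P : probability T R := HB.pack (discrete_measure p q) HP.
by exists P.
Qed.

(** * Couplings of two discrete measures as weight matrices *)

Section discrete_couplings.
Context d1 d2 (T1 : measurableType d1) (T2 : measurableType d2) (R : realType).
Context (n m : nat) (a : 'I_n -> R) (x : 'I_n -> T1) (b : 'I_m -> R) (y : 'I_m -> T2).
Hypotheses (x_inj : injective x) (y_inj : injective y).
Hypotheses (mx : forall i, measurable [set x i]) (my : forall j, measurable [set y j]).
Hypotheses (a_ge0 : forall i, 0 <= a i) (b_ge0 : forall j, 0 <= b j).
Let q (k : 'I_n * 'I_m) := (x k.1, y k.2).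

Lemma grid_inj : injective q.
Proof. by move=> [i j] [i' j'] [/x_inj -> /y_inj ->]. Qed.

Lemma measurable_grid1 k : measurable [set q k].
Proof.
rewrite (_ : [set q k] = [set x k.1] `*` [set y k.2]); first exact: measurableX.
by apply/seteqP; split => [z ->|[u v] [/= -> ->]].
Qed.

Lemma discrete_coupling (P : probability (T1 * T2)%type R) (p : 'I_n * 'I_m -> R) :
  (forall k, 0 <= p k) -> P ≡μ discrete_measure p q ->
  (forall i, \sum_j p (i, j) = a i) -> (forall j, \sum_i p (i, j) = b j) ->
  couplings (discrete_measure a x) (discrete_measure b y) P.
Proof.
move=> p_ge0 PE pa pb; split => A mA.
- rewrite [LHS](measure_eq_discreteE PE)//; last first.
    by rewrite -[X in measurable X]setTI; exact: measurable_fst.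
  rewrite [RHS](discrete_measureE x A a_ge0) sumEFin; congr EFin.
  under [RHS]eq_bigr do rewrite -pa mulr_suml.
  by rewrite pair_bigA; apply: eq_bigr => -[i j] _.
- rewrite [LHS](measure_eq_discreteE PE)//; last first.
    by rewrite -[X in measurable X]setTI; exact: measurable_snd.
  rewrite [RHS](discrete_measureE y A b_ge0) sumEFin; congr EFin.
  under [RHS]eq_bigr do rewrite -pb mulr_suml.
  by rewrite exchange_big pair_bigA; apply: eq_bigr => -[i j] _.
Qed.

(** Each marginal gives no mass off its atoms, so [P] is carried by the finite grid and its weights
    are read off the singletons. *)
Lemma coupling_discrete (P : probability (T1 * T2)%type R) :
  couplings (discrete_measure a x) (discrete_measure b y) P ->
  exists p : 'I_n * 'I_m -> R, [/\ forall k, 0 <= p k,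
    P ≡μ discrete_measure p q, forall i, \sum_j p (i, j) = a i &
    forall j, \sum_i p (i, j) = b j].
Proof.
move=> [Pa Pb]; pose p k := fine (P [set q k]).
have p_ge0 k : 0 <= p k by exact: fine_ge0.
have pE k : P [set q k] = (p k)%:E by rewrite fineK// fin_num_measure// ; exact: measurable_grid1.
pose X := \bigcup_i [set x i]; pose Y := \bigcup_j [set y j].
have mX : measurable X by apply: fin_bigcup_measurable => // i _; exact: mx.
have mY : measurable Y by apply: fin_bigcup_measurable => // j _; exact: my.
have mfst A : measurable A -> measurable (fst @^-1` A : set (T1 * T2)).
  by move=> mA; rewrite -[X in measurable X]setTI; exact: measurable_fst.
have msnd A : measurable A -> measurable (snd @^-1` A : set (T1 * T2)).
  by move=> mA; rewrite -[X in measurable X]setTI; exact: measurable_snd.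
have PX0 : P (fst @^-1` (~` X)) = 0%E.
  have := measure_eq_discreteE Pa a_ge0 (measurableC mX).
  rewrite big1 => [//|i _].
  by rewrite indicE memNset ?mulr0// => /=; apply; exists i.
have PY0 : P (snd @^-1` (~` Y)) = 0%E.
  have := measure_eq_discreteE Pb b_ge0 (measurableC mY).
  rewrite big1 => [//|j _].
  by rewrite indicE memNset ?mulr0// => /=; apply; exists j.
have mXY : measurable (X `*` Y) by exact: measurableX.
have PE : P ≡μ discrete_measure p q.
  move=> A mA; rewrite [RHS](discrete_measureE q A p_ge0).
  have PN : P (A `\` (X `*` Y)) = 0%E.
    have mN : measurable (fst @^-1` (~` X) `|` snd @^-1` (~` Y) : set (T1 * T2)).
      by apply: measurableU; [apply: mfst|apply: msnd]; exact: measurableC.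
    apply: (subset_measure0 _ mN) => [|z [_ nXY]|].
    - exact: measurableD.
    - have [Xz|] := pselect (X z.1); last by left.
      by right => Yz; apply: nXY.
    - by apply: null_set_setU => //; [apply: mfst|apply: msnd]; exact: measurableC.
  rewrite (measureDI P mA mXY) [X in (X + _)%E]PN add0e.
  have -> : A `&` (X `*` Y) = \bigcup_k (A `&` [set q k]).
    apply/seteqP; split => [[u v] [Auv [[i _ /= ui] [j _ /= vj]]]|z [k _ [Az /= zk]]].
      by exists (i, j) => //; split => //; rewrite ui vj.
    by split => //; rewrite zk; split => /=; [exists k.1|exists k.2].
  rewrite measure_fin_bigcup//; last 3 first.
  - exact: finite_finset.
  - move=> k l _ _ [z [[_ /= zk] [_ /= zl]]].
    by apply: grid_inj; rewrite -[LHS]zk.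
  - by move=> k _; apply: measurableI => //; exact: measurable_grid1.
  have -> : [set: 'I_n * 'I_m] = [set` index_enum ('I_n * 'I_m)%type].
    by apply/seteqP; split => k //= _; rewrite mem_index_enum.
  rewrite -fsbig_seq ?index_enum_uniq//; apply: eq_bigr => k _.
  rewrite indicE; have [Ak|Ak] := boolP (q k \in A).
    rewrite mulr1 -pE; congr (P _); apply/seteqP; split => [z []//|z ->].
    by split => //; exact/set_mem.
  rewrite mulr0 (_ : _ `&` _ = set0) ?measure0//.
  apply/seteqP; split => z // -[Az zk]; move/negP: Ak; apply.
  by rewrite -zk; exact: mem_set.
exists p; split => //.
- move=> i; have := measure_eq_discreteE PE p_ge0 (mfst _ (mx i)).
  rewrite [LHS](measure_eq_discreteE Pa a_ge0 (mx i)) => -[].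
  rewrite (bigD1 i)//= big1 => [|i' ii']; last first.
    rewrite indicE memNset ?mulr0// => /= /x_inj /eqP.
    by apply/negP.
  rewrite indicE mem_set// mulr1 addr0 => ->.
  rewrite -(pair_bigA _ (fun i' j => p (i', j) * \1_(fst @^-1` [set x i]) (q (i', j))))/=.
  rewrite (bigD1 i)//= [X in _ = _ + X]big1 => [|i' ii'].
    by rewrite addr0; apply: eq_bigr => j _; rewrite indicE mem_set// mulr1.
  rewrite big1// => j _; rewrite indicE memNset ?mulr0// => /= /x_inj /eqP.
  by apply/negP.
- move=> j; have := measure_eq_discreteE PE p_ge0 (msnd _ (my j)).
  rewrite [LHS](measure_eq_discreteE Pb b_ge0 (my j)) => -[].
  rewrite (bigD1 j)//= big1 => [|j' jj']; last first.
    rewrite indicE memNset ?mulr0// => /= /y_inj /eqP.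
    by apply/negP.
  rewrite indicE mem_set// mulr1 addr0 => ->.
  rewrite -(pair_bigA _ (fun i j' => p (i, j') * \1_(snd @^-1` [set y j]) (q (i, j'))))/=.
  rewrite exchange_big (bigD1 j)//= [X in _ = _ + X]big1 => [|j' jj'].
    by rewrite addr0; apply: eq_bigr => i _; rewrite indicE mem_set// mulr1.
  rewrite big1// => i _; rewrite indicE memNset ?mulr0// => /= /y_inj /eqP.
  by apply/negP.
Qed.

End discrete_couplings.

(** * Asymptotics *)

(** Pairs carry the product sigma-algebra, while continuity refers to the product topology.
    Concatenating the two rows passes to ['rV[R]_(n + n)], where open sets generate the
    sigma-algebra. *)
Lemma continuous_measurable_rV2 (R : realType) n (f : 'rV[R]_n * 'rV[R]_n -> R) :
  continuous f -> measurable_fun setT f.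
Proof.
move=> cf; pose g (w : 'rV[R]_(n + n)) := f (lsubmx w, rsubmx w).
have cg : continuous g.
  move=> w.
  have cl : (fun v : 'rV[R]_(n + n) => lsubmx v) @ w --> (lsubmx w : 'rV[R]_n).
    move=> B /nbhs_ballP[e e0 eB]; apply/nbhs_ballP; exists e => // v [_ wv].
    by apply: eB; split => // i j; rewrite !mxE; exact: wv.
  have cr : (fun v : 'rV[R]_(n + n) => rsubmx v) @ w --> (rsubmx w : 'rV[R]_n).
    move=> B /nbhs_ballP[e e0 eB]; apply/nbhs_ballP; exists e => // v [_ wv].
    by apply: eB; split => // i j; rewrite !mxE; exact: wv.
  exact: (@cvg_comp _ _ _ (fun v : 'rV[R]_(n + n) => (lsubmx v, rsubmx v)) f _ _ _
    (cvg_pair cl cr) (cf (lsubmx w, rsubmx w))).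
have mg : measurable_fun setT g.
  apply: (measurability _ (RGenOpens.measurableE R)) => _ [_ [a [b ->] <-]].
  rewrite setTI; apply: sub_sigma_algebra.
  apply: open_comp; last exact: interval_open.
  by move=> v _; exact: cg.
have -> : f = g \o (fun z => row_mx z.1 z.2).
  by apply/funext => -[u v]; rewrite /g /= row_mxKl row_mxKr.
apply: (measurableT_comp mg); apply: measurable_rV => i.
under eq_fun do rewrite mxE.
case: (@fintype.split n n i) => j.
  exact: (measurableT_comp (measurable_coord j) measurable_fst).
exact: (measurableT_comp (measurable_coord j) measurable_snd).
Qed.

(** From [exp t <= 1 / (1 - t)] and [(1 - t) (1 + t + 2 t^2) = 1 + t^2 (1 - 2 t) >= 1]. It controls
    the second order in [t] of the tilted mass. *)
Lemma expR_le_quadratic (R : realType) (t : R) : t <= 2^-1 ->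
  expR t <= 1 + t + 2 * t ^+ 2.
Proof.
move=> t12; have t1 : 0 < 1 - t by lra.
apply: (@le_trans _ _ (1 - t)^-1).
  rewrite -[leLHS]invrK -expRN lef_pV2 ?posrE ?expR_gt0//.
  exact: expR_ge1Dx.
rewrite -(ler_pM2r t1) mulVf ?gt_eqF// -subr_ge0.
rewrite (_ : _ - _ = t ^+ 2 * (1 - 2 * t)); last by ring.
by rewrite mulr_ge0 ?sqr_ge0//; lra.
Qed.

Section asymptotics.
Context {R : realType} {d n m : nat}.
Local Notation V := 'rV[R]_d.
Variables (a : 'I_n -> R) (x : 'I_n -> V) (b : 'I_m -> R) (y : 'I_m -> V).
Hypotheses (a_gt0 : forall i, 0 < a i) (b_gt0 : forall j, 0 < b j)
  (sum_a : \sum_(i < n) a i = 1) (sum_b : \sum_(j < m) b j = 1)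
  (x_inj : injective x) (y_inj : injective y).
Variables (gamma : probability (V * V)%type R) (rho : V * V -> R) (M : R).
Hypotheses (rho_density : has_density gamma rho) (rho_gt0 : forall z, 0 < rho z)
  (rho_le : forall z, rho z <= M)
  (rho_cont : forall i j, {for (x i, y j), continuous rho}).

Let q (k : 'I_n * 'I_m) := (x k.1, y k.2).
Let s (k : 'I_n * 'I_m) := (2 * pi) ^+ d * rho (q k).

Variables (alpha : 'I_n -> R) (beta : 'I_m -> R).
Let w (k : 'I_n * 'I_m) := expR (alpha k.1 + beta k.2) * s k.
Hypotheses (w_a : forall i, \sum_j w (i, j) = a i)
  (w_b : forall j, \sum_i w (i, j) = b j).

(** The dual value of the discrete problem; [entropy_w] identifies it with the primal value. *)
Let H0 := \sum_i a i * alpha i + \sum_j b j * beta j.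

Let s_gt0 k : 0 < s k.
Proof. by rewrite mulr_gt0// exprn_gt0// mulr_gt0// pi_gt0. Qed.

Let w_gt0 k : 0 < w k. Proof. by rewrite mulr_gt0// expR_gt0. Qed.

Let a_ge0 i := ltW (a_gt0 i).
Let b_ge0 j := ltW (b_gt0 j).

Let sum_w : \sum_k w k = 1.
Proof.
rewrite -sum_a; under [RHS]eq_bigr do rewrite -w_a.
by rewrite pair_bigA; apply: eq_bigr => -[].
Qed.

Let sum_potential (p : 'I_n * 'I_m -> R) : (forall i, \sum_j p (i, j) = a i) ->
  (forall j, \sum_i p (i, j) = b j) ->
  \sum_k p k * (alpha k.1 + beta k.2) = H0.
Proof.
move=> pa pb; under eq_bigr do rewrite mulrDr.
rewrite big_split/=; congr (_ + _).
  under [RHS]eq_bigr do rewrite -pa mulr_suml.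
  by rewrite pair_bigA; apply: eq_bigr => -[].
under [RHS]eq_bigr do rewrite -pb mulr_suml.
by rewrite exchange_big pair_bigA; apply: eq_bigr => -[].
Qed.

(** Pythagorean identity: [ln (w k / s k)] is a function of the row plus a function of the column,
    so its integral is [H0] under every coupling. Minimality and uniqueness of [w] then come from
    Gibbs' inequality. *)
Let entropyE (p : 'I_n * 'I_m -> R) : (forall k, 0 <= p k) ->
  (forall i, \sum_j p (i, j) = a i) -> (forall j, \sum_i p (i, j) = b j) ->
  \sum_k p k * ln (p k / s k) = \sum_k p k * ln (p k / w k) + H0.
Proof.
move=> p0 pa pb; rewrite -(sum_potential pa pb) -big_split/=.
apply: eq_bigr => k _; have := p0 k; rewrite le0r => /orP[/eqP ->|pk].
  by rewrite !mul0r addr0.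
rewrite -mulrDr; congr (_ * _).
have -> : p k / s k = p k / w k * expR (alpha k.1 + beta k.2).
  by rewrite /w; field; rewrite !gt_eqF ?expR_gt0.
by rewrite lnM ?posrE ?expR_gt0 ?divr_gt0// expRK.
Qed.

Let entropy_w : \sum_k w k * ln (w k / s k) = H0.
Proof.
rewrite entropyE// => [|k]; last exact: ltW.
rewrite big1 ?add0r// => k _; by rewrite divff ?gt_eqF// ln1 mulr0.
Qed.

Lemma relative_entropy_scaling (pi0 : probability (V * V)%type R) :
  pi0 ≡μ discrete_measure w q ->
  relative_entropy pi0 (discrete_measure s q) = H0%:E.
Proof.
move=> pi0E; have q_inj : injective q by exact: grid_inj.
have mq k : measurable [set q k].
  by apply: measurable_grid1 => i; exact: measurable_set1_rV.
rewrite (relative_entropy_discrete q_inj mq _ s_gt0 pi0E) ?entropy_w// => k.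
exact: ltW.
Qed.

Lemma unique_minimizer_scaling (pi0 : probability (V * V)%type R) :
  pi0 ≡μ discrete_measure w q ->
  unique_minimizer (couplings (discrete_measure a x) (discrete_measure b y))
    (fun P => relative_entropy P (discrete_measure s q)) pi0.
Proof.
move=> pi0E.
have mx i : measurable [set x i] by exact: measurable_set1_rV.
have my j : measurable [set y j] by exact: measurable_set1_rV.
have q_inj : injective q by exact: grid_inj.
have mq k : measurable [set q k] by exact: measurable_grid1.
have c0 : couplings (discrete_measure a x) (discrete_measure b y) pi0.
  by apply: discrete_coupling pi0E w_a w_b => // k; exact: ltW.
have e0 : relative_entropy pi0 (discrete_measure s q) = H0%:E.
  exact: relative_entropy_scaling.
have eQ (Q : probability (V * V)%type R) :
    couplings (discrete_measure a x) (discrete_measure b y) Q ->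
    exists p : 'I_n * 'I_m -> R, [/\ forall k, 0 <= p k, Q ≡μ discrete_measure p q,
      \sum_k p k = \sum_k w k &
      relative_entropy Q (discrete_measure s q) =
        (\sum_k p k * ln (p k / w k) + H0)%:E].
  move=> cQ.
  have [p [p0 QE pa pb]] := coupling_discrete x_inj y_inj mx my a_ge0 b_ge0 cQ.
  exists p; split => //.
    rewrite sum_w -sum_a; under [RHS]eq_bigr do rewrite -pa.
    by rewrite pair_bigA; apply: eq_bigr => -[].
  by rewrite (relative_entropy_discrete q_inj mq _ s_gt0 QE)// entropyE.
split.
  split => // Q /eQ[p [p0 QE spw ->]].
  by rewrite e0 lee_fin lerDr gibbs_ge0.
move=> Q [cQ Qmin]; have [p [p0 QE spw eq]] := eQ Q cQ.
have := Qmin _ c0; rewrite eq e0 lee_fin gerDr => le0.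
have pw : p = w.
  apply: gibbs_eq0 => //; apply/eqP; rewrite eq_le le0/=; exact: gibbs_ge0.
by move=> A mA; rewrite (QE _ mA) (pi0E _ mA) pw.
Qed.

Let rho_ge0 z : 0 <= rho z := ltW (rho_gt0 z).

Let cell_mass_cvg k :
  (e ^+ d)^-1 * cell_mass x y gamma e k @[e --> 0^'+] --> s k.
Proof.
pose A := cell x k.1 `*` cell y k.2.
have nA : nbhs (q k) A.
  by exists (cell x k.1, cell y k.2) => //; split; exact: nbhs_cell.
have A1 : \1_A (q k) = 1 :> R by rewrite indicE mem_set//; exact: nbhs_singleton nA.
rewrite -[s k]mulr1 -A1.
apply: (@laplace_density_cvg _ _ gamma rho _ M 1) => //.
- by apply: measurable_indic; apply: measurableX; exact: measurable_cell.
- change (\1_A @ q k --> (\1_A (q k) : R)); rewrite A1; apply: cvg_near_cst.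
  by apply: filterS nA => z Az; rewrite indicE mem_set.
Qed.

Let sum_wf_gt0 (f : V * V -> R) : 0 < \sum_k w k * expR (f (q k)).
Proof.
have n0 := sum1_gt0 sum_a; have m0 := sum1_gt0 sum_b.
rewrite (bigD1 (Ordinal n0, Ordinal m0))//= ltr_pwDl//.
  by rewrite pmulr_rgt0// expR_gt0.
by apply: sumr_ge0 => k _; rewrite pmulr_rge0// expR_ge0.
Qed.

Section lower.
Variables (f : V * V -> R) (K : R).
Hypotheses (cf : continuous f) (fK : forall z, `|f z| <= K).

(** Kept for a general [f]: the value 0 serves the energy expansion, and a small multiple of the
    test function serves the weak limit. *)
Let mass (e : R) := \sum_i \sum_j expR (alpha i + beta j) *
            \int[gamma]_z (expR (f z) * gaussian2 e (x i, y j) z).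

Lemma mass_cvg :
  (e ^+ d)^-1 * mass e @[e --> 0^'+] --> \sum_k w k * expR (f (q k)).
Proof.
have -> : (fun e : R => (e ^+ d)^-1 * mass e) = fun e => \sum_i \sum_j
   expR (alpha i + beta j) *
     ((e ^+ d)^-1 * \int[gamma]_z (expR (f z) * gaussian2 e (x i, y j) z)).
  apply/funext => e; rewrite mulr_sumr; apply: eq_bigr => i _.
  by rewrite mulr_sumr; apply: eq_bigr => j _; rewrite mulrCA.
have -> : \sum_k w k * expR (f (q k)) = \sum_i \sum_j
   expR (alpha i + beta j) * ((2 * pi) ^+ d * rho (x i, y j) * expR (f (x i, y j))).
  by rewrite pair_bigA; apply: eq_bigr => -[i j] _; rewrite /w /s /=; ring.
apply: cvg_big => [|i _]; first exact: add_continuous.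
apply: cvg_big => [|j _]; first exact: add_continuous.
apply: cvgM; first exact: cvg_cst.
apply: (@laplace_density_cvg _ _ gamma rho _ M (expR K)) => //.
- exact: (measurableT_comp (@measurable_expR R) (continuous_measurable_rV2 cf)).
- by move=> z; rewrite ler_expR (le_trans (ler_norm _)).
- apply: (@cvg_comp _ _ _ f expR _ (nbhs (f (x i, y j)))); first exact: cf.
  exact: continuous_expR.
Qed.

Let mass_gt0 (e : R) : 0 < e -> 0 < mass e.
Proof.
move=> e0; have n0 := sum1_gt0 sum_a; have m0 := sum1_gt0 sum_b.
have I0 i j : 0 < \int[gamma]_z (expR (f z) * gaussian2 e (x i, y j) z).
  apply: (@Rintegral_gt0 _ _ _ _ _ (expR K)).
  - apply: measurable_funM; last exact: measurable_gaussian2.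
    exact: (measurableT_comp (@measurable_expR R) (continuous_measurable_rV2 cf)).
  - by move=> z; rewrite mulr_gt0 ?expR_gt0 ?gaussian2_gt0.
  - move=> z; rewrite ger0_norm ?mulr_ge0 ?expR_ge0 ?(ltW (gaussian2_gt0 _ _ _))//.
    rewrite (@le_trans _ _ (expR (f z)))// ?ler_piMr ?expR_ge0 ?gaussian2_le1//.
    by rewrite ler_expR (le_trans (ler_norm _)).
have J0 i : 0 < \sum_j expR (alpha i + beta j) *
    \int[gamma]_z (expR (f z) * gaussian2 e (x i, y j) z).
  rewrite (bigD1 (Ordinal m0))//= ltr_pwDl ?mulr_gt0 ?expR_gt0//.
  by apply: sumr_ge0 => j _; rewrite mulr_ge0 ?expR_ge0// ltW.
rewrite /mass (bigD1 (Ordinal n0))//= ltr_pwDl//.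
by apply: sumr_ge0 => i _; exact: ltW.
Qed.

(** Gaussian integrals over pairs of points of dimension [d] scale like [e ^+ d]; this is the origin
    of the term [d ln e]. *)
Lemma ln_mass_cvg : ln (mass e) - d%:R * ln e @[e --> 0^'+] -->
  ln (\sum_k w k * expR (f (q k))).
Proof.
have : ln ((e ^+ d)^-1 * mass e) @[e --> 0^'+] --> ln (\sum_k w k * expR (f (q k))).
  apply: (cvg_comp _ _ mass_cvg); exact: (continuous_ln (sum_wf_gt0 f)).
apply: cvg_trans; apply: near_eq_cvg; near=> e.
have e0 : 0 < e by [].
rewrite /= lnM ?posrE ?invr_gt0 ?exprn_gt0 ?mass_gt0// lnV ?posrE ?exprn_gt0//.
by rewrite lnXn// addrC mulr_natl.
Unshelve. all: by end_near. Qed.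

Lemma cost_lower_bound (e : R) (P : probability (V * V)%type R) : 0 < e ->
  ((H0 + \int[P]_z f z - ln (mass e))%:E <=
   entropic_cost (discrete_measure a x) (discrete_measure b y) gamma e P)%E.
Proof.
move=> e0; apply: entropic_cost_ge fK => //.
exact: continuous_measurable_rV2.
Qed.

End lower.

Variable P : R -> probability (V * V)%type R.
Hypothesis P_min : forall e, 0 < e -> forall Q,
  (entropic_cost (discrete_measure a x) (discrete_measure b y) gamma e (P e) <=
   entropic_cost (discrete_measure a x) (discrete_measure b y) gamma e Q)%E.

(** The cost bound of the competitor built on the Schroedinger coupling, that is, with [p = w]. *)
Let U (e : R) := \sum_k w k * ln (w k / cell_mass x y gamma e k).

Let cell_mass_gt0 : \forall e \near 0^'+, forall k, 0 < cell_mass x y gamma e k.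
Proof.
apply: filter_forall => k; near=> e.
have e0 : 0 < e by [].
have : 0 < (e ^+ d)^-1 * cell_mass x y gamma e k.
  by near: e; exact: (cvgr_gt _ (@cell_mass_cvg k) 0 (s_gt0 k)).
by rewrite pmulr_rgt0// invr_gt0 exprn_gt0.
Unshelve. all: by end_near. Qed.

Lemma cost_upper_bound : \forall e \near 0^'+,
  (entropic_cost (discrete_measure a x) (discrete_measure b y) gamma e (P e) <=
   (U e)%:E)%E.
Proof.
near=> e; have e0 : 0 < e by [].
have cm : forall k, 0 < cell_mass x y gamma e k by near: e; exact: cell_mass_gt0.
have [Q] := entropic_cost_le e0 (fun k => ltW (w_gt0 k)) w_a w_b sum_a cm.
by apply: le_trans; exact: P_min.
Unshelve. all: by end_near. Qed.

(** Each cell mass carries a factor [e ^+ d], and since the weights [w] sum to 1 these contribute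
    [d ln e] exactly once. *)
Lemma upper_cvg : U e + d%:R * ln e @[e --> 0^'+] --> H0.
Proof.
rewrite -entropy_w.
have : \sum_k w k * ln (w k / ((e ^+ d)^-1 * cell_mass x y gamma e k)) @[e --> 0^'+]
    --> \sum_k w k * ln (w k / s k).
  apply: cvg_big => [|k _]; first exact: add_continuous.
  apply: cvgM; first exact: cvg_cst.
  have wV : w k / ((e ^+ d)^-1 * cell_mass x y gamma e k) @[e --> 0^'+] --> w k / s k.
    apply: cvgM; first exact: cvg_cst.
    by apply: (cvgV _ (@cell_mass_cvg k)); rewrite gt_eqF.
  by apply: (cvg_comp _ _ wV); apply: continuous_ln; exact: divr_gt0.
apply: cvg_trans; apply: near_eq_cvg; near=> e.
have e0 : 0 < e by [].
have cm : forall k, 0 < cell_mass x y gamma e k by near: e; exact: cell_mass_gt0.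
have -> : U e + d%:R * ln e = \sum_k w k * (ln (w k / cell_mass x y gamma e k) + d%:R * ln e).
  under eq_bigr do rewrite mulrDr.
  by rewrite big_split/= -mulr_suml sum_w mul1r.
apply: eq_bigr => k _; congr (_ * _).
have -> : w k / ((e ^+ d)^-1 * cell_mass x y gamma e k) =
    w k / cell_mass x y gamma e k * e ^+ d by rewrite invfM invrK mulrCA mulrC.
have wc : 0 < w k / cell_mass x y gamma e k by exact: divr_gt0.
have ed : 0 < e ^+ d by exact: exprn_gt0.
by rewrite (lnM wc ed) lnXn// mulr_natl.
Unshelve. all: by end_near. Qed.

Lemma entropic_cost_asymptotics :
  (entropic_cost (discrete_measure a x) (discrete_measure b y) gamma e (P e)
    - ((- d%:R * ln e)%:E + H0%:E))%E @[e --> 0^'+] --> 0%E.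
Proof.
pose z0 : V * V -> R := fun=> 0.
have cz : continuous z0 by move=> z; exact: cvg_cst.
have zK z : `|z0 z| <= 0 by rewrite normr0.
have lo := ln_mass_cvg cz zK; have up := upper_cvg.
(* With [f = 0] the limiting mass is the total mass of [w]; its logarithm vanishes, so both bounds
   converge to [H0]. *)
have lim0 : \sum_k w k * expR (z0 (q k)) = 1.
  by under eq_bigr do rewrite expR0 mulr1.
rewrite lim0 ln1 in lo.
apply: (@squeeze_cvge _ _ _ _
  (fun e => (- (ln (\sum_i \sum_j expR (alpha i + beta j) *
     \int[gamma]_z (expR (z0 z) * gaussian2 e (x i, y j) z)) - d%:R * ln e))%:E) _
  (fun e => (U e + d%:R * ln e - H0)%:E)).
- near=> e; have e0 : 0 < e by [].
  rewrite -EFinD; apply/andP; split.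
    rewrite leeBrDr// -EFinD.
    apply: le_trans (cost_lower_bound cz zK (P e) e0).
    rewrite lee_fin /z0 Rintegral_prob_cst; lra.
  rewrite leeBlDr// -EFinD.
  have /le_trans : (entropic_cost (discrete_measure a x) (discrete_measure b y) gamma e (P e) <=
   (U e)%:E)%E by near: e; exact: cost_upper_bound.
  by apply; rewrite lee_fin; lra.
- apply: cvg_EFin; first exact: nearW.
  have lo' := cvgN lo; rewrite oppr0 in lo'; exact: lo'.
- apply: cvg_EFin; first exact: nearW.
  have up' : U e + d%:R * ln e - H0 @[e --> 0^'+] --> H0 - H0.
    by apply: cvgB => //; exact: cvg_cst.
  rewrite subrr in up'; exact: up'.
Unshelve. all: by end_near. Qed.

Section weak.
Variables (f : V * V -> R) (K : R).
Hypotheses (cf : continuous f) (fK : forall z, `|f z| <= K).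

Let integral_scale (e t : R) : t * \int[P e]_z f z = \int[P e]_z (t * f z).
Proof.
rewrite RintegralZl//; apply: bounded_integrable fK.
exact: continuous_measurable_rV2.
Qed.

(** At the minimizer, the lower bound tested on [t f] lies below the upper bound. In the limit this
    leaves [ln (\sum_k w k * exp (t f))], which is linear in [t] up to a quadratic error, and the
    inequality is divided by a small fixed [t]. *)
Lemma limsup_integral (eta : R) : 0 < eta -> \forall e \near 0^'+,
  \int[P e]_z f z <= \sum_k w k * f (q k) + eta.
Proof.
move=> eta0; pose F0 := \sum_k w k * f (q k).
have K0 : 0 <= K by apply: le_trans (fK (0, 0)).
(* [K1] is positive even if [K] is 0. The first bound on [t] puts [t f] in the range of the
   quadratic estimate of exp; the second makes its error [2 (t K1)^2] at most [t * (eta / 2)]. *)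
pose K1 := K + 1; have K10 : 0 < K1 by rewrite ltr_wpDl.
pose t := Num.min (2 * K1)^-1 (eta / (4 * K1 ^+ 2)).
have t0 : 0 < t.
  by rewrite lt_min invr_gt0 mulr_gt0//= divr_gt0// mulr_gt0// exprn_gt0.
have tK : t * K1 <= 2^-1.
  apply: (@le_trans _ _ ((2 * K1)^-1 * K1)).
    by rewrite ler_wpM2r ?(ltW K10)// ge_min lexx.
  by rewrite invfM mulfVK// gt_eqF.
have tK2 : 2 * t * K1 ^+ 2 <= eta / 2.
  apply: (@le_trans _ _ (2 * (eta / (4 * K1 ^+ 2)) * K1 ^+ 2)).
    by rewrite ler_wpM2r ?sqr_ge0// ler_wpM2l// ge_min lexx orbT.
  rewrite -subr_ge0 (_ : _ - _ = 0)//; field; rewrite gt_eqF//.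
pose tf z := t * f z.
have ctf : continuous tf by move=> z; apply: cvgM; [exact: cvg_cst|exact: cf].
have fK1 z : `|f z| <= K1 by rewrite (le_trans (fK z))// lerDl.
have tfK z : `|tf z| <= 2^-1.
  by rewrite normrM (ger0_norm (ltW t0)) (le_trans _ tK)// ler_wpM2l// ltW.
have lM : ln (\sum_k w k * expR (tf (q k))) <= t * (F0 + eta / 2).
  have M1 : \sum_k w k * expR (tf (q k)) <= 1 + t * (F0 + eta / 2).
    apply: (@le_trans _ _ (\sum_k (w k + t * (w k * f (q k)) + w k * (t * (eta / 2))))).
      apply: ler_sum => k _.
      have e1 : expR (tf (q k)) <= 1 + tf (q k) + 2 * tf (q k) ^+ 2.
        by apply: expR_le_quadratic; rewrite (le_trans (ler_norm _)).
      have e2 : 2 * tf (q k) ^+ 2 <= t * (eta / 2).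
        rewrite /tf exprMn mulrCA expr2 -mulrA ler_wpM2l ?(ltW t0)// mulrCA mulrA.
        apply: le_trans tK2; rewrite ler_wpM2l ?mulr_ge0 ?(ltW t0)//.
        by rewrite -real_normK ?num_real// lerXn2r// nnegrE ltW.
      have {}e1 := ler_wpM2l (ltW (w_gt0 k)) e1.
      have {}e2 := ler_wpM2l (ltW (w_gt0 k)) e2.
      by rewrite /tf in e1 e2 *; lra.
    by rewrite !big_split/= -mulr_sumr -mulr_suml sum_w mul1r mulrDr addrA.
  have Mp : 0 < \sum_k w k * expR (tf (q k)) by exact: sum_wf_gt0.
  rewrite -[X in ln X](subrK 1) addrC; apply: le_trans (le_ln1Dx _) _; lra.
have lo := ln_mass_cvg ctf tfK; have up := upper_cvg.
(* The two convergences are allowed [t * (eta / 4)] each; with the quadratic error the total is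
   [t * eta]. *)
have te : 0 < t * (eta / 4) by rewrite mulr_gt0// divr_gt0.
near=> e; have e0 : 0 < e by [].
have LB := cost_lower_bound ctf tfK (P e) e0.
have UB : (entropic_cost (discrete_measure a x) (discrete_measure b y) gamma e (P e) <=
   (U e)%:E)%E by near: e; exact: cost_upper_bound.
have := le_trans LB UB; rewrite lee_fin -integral_scale => h.
have h1 : ln (\sum_i \sum_j expR (alpha i + beta j) *
     \int[gamma]_z (expR (tf z) * gaussian2 e (x i, y j) z)) - d%:R * ln e <=
   ln (\sum_k w k * expR (tf (q k))) + t * (eta / 4).
  by near: e; apply: (cvgr_le _ lo); rewrite ltrDl.
have h2 : U e + d%:R * ln e <= H0 + t * (eta / 4).
  by near: e; apply: (cvgr_le _ up); rewrite ltrDl.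
rewrite -(ler_pM2l t0) -/F0; lra.
Unshelve. all: by end_near. Qed.

End weak.

Lemma weak_limit (pi0 : probability (V * V)%type R) :
  pi0 ≡μ discrete_measure w q -> weakly_cvg 0^'+ P pi0.
Proof.
move=> pi0E f cf [K fK].
have mf := continuous_measurable_rV2 cf.
have q_inj : injective q by exact: grid_inj.
have mq k : measurable [set q k] by apply: measurable_grid1 => i; exact: measurable_set1_rV.
rewrite (@integral_discrete _ _ _ _ q w pi0 q_inj mq _ pi0E _ (fun k => f (q k)))//; last 2 first.
- by move=> k; exact: ltW.
- exact/measurable_EFinP.
under eq_cvg do rewrite (EFin_Rintegral (P _) mf fK).
apply: cvg_EFin; first exact: nearW.
apply/cvgrPdist_le => eta eta0.
have cNf : continuous (fun z => - f z) by move=> z; apply: cvgN; exact: cf.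
have NfK z : `|- f z| <= K by rewrite normrN.
have up := limsup_integral cf fK eta0.
have lo := limsup_integral cNf NfK eta0.
near=> e.
have h1 : \int[P e]_z f z <= \sum_k w k * f (q k) + eta by near: e.
have h2 : \int[P e]_z (- f z) <= \sum_k w k * - f (q k) + eta by near: e.
have : \int[P e]_z (- f z) = - \int[P e]_z f z.
  rewrite -mulN1r -RintegralZl//; last exact: bounded_integrable fK.
  by congr fine; apply: eq_integral => z _; rewrite mulN1r.
move=> E; rewrite E in h2.
rewrite (eq_bigr (fun k => - (w k * f (q k)))) in h2; last first.
  by move=> k _; rewrite mulrN.
rewrite sumrN in h2; rewrite /= -[X in _ - X]/(\int[P e]_z f z).
rewrite ler_norml; apply/andP; split; lra.
Unshelve. all: by end_near. Qed.

End asymptotics.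

Theorem theorem4p2 (R : realType) (d n m : nat)
  (a : 'I_n -> R) (x : 'I_n -> 'rV[R]_d)
  (b : 'I_m -> R) (y : 'I_m -> 'rV[R]_d)
  (a_gt0 : forall i, 0 < a i) (b_gt0 : forall j, 0 < b j)
  (sum_a : \sum_(i < n) a i = 1) (sum_b : \sum_(j < m) b j = 1)
  (x_inj : injective x) (y_inj : injective y)
  (gamma : probability ('rV[R]_d * 'rV[R]_d)%type R)
  (rho : 'rV[R]_d * 'rV[R]_d -> R)
  (rho_density : has_density gamma rho)
  (rho_gt0 : forall z, 0 < rho z)
  (rho_bounded : exists M : R, forall z, rho z <= M)
  (rho_cont : forall i j, \forall z \near (x i, y j), {for z, continuous rho})
  (pi_eps : R -> probability ('rV[R]_d * 'rV[R]_d)%type R) :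
  let mu := discrete_measure a x in
  let nu := discrete_measure b y in
  let sigma := discrete_measure
    (fun ij : 'I_n * 'I_m => (2 * pi) ^+ d * rho (x ij.1, y ij.2))
    (fun ij : 'I_n * 'I_m => (x ij.1, y ij.2)) in
  (forall eps, 0 < eps ->
     unique_minimizer setT (entropic_cost mu nu gamma eps) (pi_eps eps)) ->
  exists pi0 : probability ('rV[R]_d * 'rV[R]_d)%type R,
    [/\ unique_minimizer (couplings mu nu)
           (fun P => relative_entropy P sigma) pi0,
        weakly_cvg 0^'+ pi_eps pi0 &
        (entropic_cost mu nu gamma eps (pi_eps eps)
           - ((- d%:R * ln eps)%:E + relative_entropy pi0 sigma))%E
          @[eps --> 0^'+] --> 0%E].
Proof.
move=> mu nu sigma pi_min.
have [M rho_le] := rho_bounded.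
have {}rho_cont i j : {for (x i, y j), continuous rho}.
  exact: (nbhs_singleton (rho_cont i j)).
have s_gt0 i j : 0 < (2 * pi) ^+ d * rho (x i, y j).
  by rewrite mulr_gt0// exprn_gt0// mulr_gt0// pi_gt0.
have [alpha [beta [w_a w_b]]] := ex_scaling a_gt0 b_gt0 sum_a sum_b s_gt0.
(* The weights of [sigma] rescaled by the Schroedinger potentials; they define the candidate limit
   [pi0]. *)
pose w (k : 'I_n * 'I_m) :=
  expR (alpha k.1 + beta k.2) * ((2 * pi) ^+ d * rho (x k.1, y k.2)).
have w_ge0 k : 0 <= w k by rewrite ltW// mulr_gt0 ?expR_gt0.
have sum_w : \sum_k w k = 1.
  rewrite -sum_a; under [RHS]eq_bigr do rewrite -w_a.
  by rewrite pair_bigA; apply: eq_bigr => -[].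
have [pi0 pi0E] := ex_discrete_probability (fun k => (x k.1, y k.2)) w_ge0 sum_w.
have P_min e : 0 < e -> forall Q,
    (entropic_cost mu nu gamma e (pi_eps e) <= entropic_cost mu nu gamma e Q)%E.
  by move=> e0 Q; exact: (pi_min e e0).1.2.
exists pi0; split.
- exact: (unique_minimizer_scaling a_gt0 b_gt0 sum_a x_inj y_inj rho_gt0 w_a w_b pi0E).
- exact: (weak_limit a_gt0 b_gt0 sum_a sum_b x_inj y_inj rho_density rho_gt0 rho_le
    rho_cont w_a w_b P_min pi0E).
- rewrite (relative_entropy_scaling x_inj y_inj rho_gt0 w_a w_b pi0E).
  exact: (entropic_cost_asymptotics a_gt0 b_gt0 sum_a sum_b x_inj y_inj rho_density
    rho_gt0 rho_le rho_cont w_a w_b P_min).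
Qed.
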